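(* The finite satisfiability problem of two-variable independence-friendly logic, $$\mathrm{FinSat}[\mathsf{IF}^2]=\{\phi \mid \phi\text{ is a sentence of }\mathsf{IF}^2\text{ and there is a finite structure }\mathfrak{A}\text{ with }\mathfrak{A}\models\phi\},$$ is $\Sigma^0_1$-complete.
   Context: Sentences are over the full relational vocabulary $\tau$ (no constant or function symbols), i.e. with countably infinitely many unary and binary relation symbols available (relation symbols are assumed at most binary). Sentences are encoded as finite words in a standard way, and completeness is with respect to computable many-one reductions. Structures have nonempty domains. Syntax. Fix variables $x,y$. Formulas of $\mathsf{IF}^2(\tau)$ are generated by $\phi::= t_1=t_2\mid R(t_1,\dots,t_n)\mid \neg t_1=t_2\mid \neg R(t_1,\dots,t_n)\mid(\phi\wedge\phi)\mid(\phi\vee\phi)\mid\forall x\phi\mid\forall y\phi\mid\exists x/W\phi\mid\exists y/W\phi$, where $R\in\tau$ is $n$-ary, $t_1,\dots,t_n\in\{x,y\}$ and $W\subseteq\{x,y\}$; $\exists x/\emptyset\,\phi$ is identified with $\exists x\phi$. Free variables $\mathrm{Fr}(\phi)$ are defined as in first-order logic, with $\mathrm{Fr}(\exists v/W\psi)=W\cup(\mathrm{Fr}(\psi)\setminus\{v\})$. A sentence is a formula with no free variables. Teams. A team $X$ of $\mathfrak{A}$ (domain $A$) with domain $\mathrm{dom}(X)=\{x_1,\dots,x_k\}$ (possibly empty) is any set of assignments $\{x_1,\dots,x_k\}\to A$. The assignment $s(a/x)$ has domain $\mathrm{dom}(s)\cup\{x\}$, maps $x$ to $a$ and agrees with $s$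 elsewhere. For $F\colon X\to A$, $X(F/x)=\{s(F(s)/x)\mid s\in X\}$, and $X(A/x)=\{s(a/x)\mid s\in X,a\in A\}$. For $W\subseteq\mathrm{dom}(X)$, $F\colon X\to A$ is $W$-independent if $F(s)=F(s')$ whenever $s,s'\in X$ agree on $\mathrm{dom}(X)\setminus W$. Semantics (with $\mathrm{Fr}(\phi)\subseteq\mathrm{dom}(X)$). (1) For a first-order literal $\phi$: $\mathfrak{A}\models_X\phi$ iff every $s\in X$ satisfies $\phi$ in $\mathfrak{A}$ in the usual sense. (2) $\mathfrak{A}\models_X\psi\wedge\phi$ iff $\mathfrak{A}\models_X\psi$ and $\mathfrak{A}\models_X\phi$. (3) $\mathfrak{A}\models_X\psi\vee\phi$ iff $X=Y\cup Z$ for some teams $Y,Z$ with $\mathfrak{A}\models_Y\psi$ and $\mathfrak{A}\models_Z\phi$. (4) $\mathfrak{A}\models_X\forall v\psi$ iff $\mathfrak{A}\models_{X(A/v)}\psi$. (5) $\mathfrak{A}\models_X\exists v/W\psi$ iff $\mathfrak{A}\models_{X(F/v)}\psi$ for some $W$-independent $F\colon X\to A$. A sentence $\phi$ is true in $\mathfrak{A}$, $\mathfrak{A}\models\phi$, if $\mathfrak{A}\models_{\{\emptyset\}}\phi$, where $\{\emptyset\}$ is the team consisting of the empty assignment. *)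

(* Defs.v *)
From HB Require Import structures.
From mathcomp Require Import all_boot.

Set Implicit Arguments.
Unset Strict Implicit.
Unset Printing Implicit Defensive.

(* ** Partial recursive functions *)

Inductive recf : nat -> Type :=
| Zero n : recf n
| Succ : recf 1
| Proj n (i : 'I_n) : recf n
| Comp k n (f : recf k) (g : 'I_k -> recf n) : recf n
| Prec n (f : recf n) (g : recf n.+2) : recf n.+1
| Mu n (f : recf n.+1) : recf n.

(* [eval f v m]: the partial function denoted by [f] is defined at [v], with
   value [m].  In [Prec f g] the recursion is on the first argument, and [g]
   receives the counter, the previous value and the parameters; [Mu f] searches
   for the least zero of [f] in its first argument and requires [f] to be
   defined at all smaller values. *)
Fixpoint eval n (f : recf n) : n.-tuple nat -> nat -> Prop :=
  match f in recf n return n.-tuple nat -> nat -> Prop with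
  | Zero _ => fun _ m => m = 0
  | Succ => fun v m => m = (thead v).+1
  | Proj _ i => fun v m => m = tnth v i
  | Comp k _ f g => fun v m =>
      exists w : k.-tuple nat, (forall i, eval (g i) v (tnth w i)) /\ eval f w m
  | Prec _ f g => fun v m =>
      let u := [tuple of behead v] in
      (fix iterate k m : Prop :=
         match k with
         | 0 => eval f u m
         | k'.+1 => exists r, iterate k' r /\ eval g [tuple of k' :: r :: u] m
         end) (thead v) m
  | Mu _ f => fun v m =>
      eval f [tuple of m :: v] 0 /\
      forall k, k < m -> exists r, eval f [tuple of k :: v] r.+1
  end.

(* ** Languages of binary words *)

Definition word := seq bool.
Definition language := word -> Prop.

(* Bijective base-2 numeration, a bijection between words and numbers. *)
Fixpoint word_num (w : word) : nat :=
  if w is b :: w' then (word_num w').*2 + b.+1 else 0.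

Definition computable (f : word -> word) : Prop :=
  exists e : recf 1, forall w, eval e [tuple word_num w] (word_num (f w)).

(* The characteristic function of [R], with values 0 and 1, is recursive. *)
Definition decidable_rel (R : word -> word -> bool) : Prop :=
  exists e : recf 2, forall w u, eval e [tuple word_num w; word_num u] (R w u).

Definition Sigma01 (L : language) : Prop :=
  exists R : word -> word -> bool,
    decidable_rel R /\ forall w, L w <-> exists u, R w u.

Definition many_one_reducible (L L' : language) : Prop :=
  exists f : word -> word, computable f /\ forall w, L w <-> L' (f w).

Definition Sigma01_complete (L : language) : Prop :=
  Sigma01 L /\ forall L' : language, Sigma01 L' -> many_one_reducible L' L.

(* ** Syntax of two-variable independence-friendly logic *)

Inductive var := vx | vy.

Definition bool_of_var v := if v is vx then false else true.
Definition var_of_bool b := if b then vy else vx.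
Lemma bool_of_varK : cancel bool_of_var var_of_bool. Proof. by case. Qed.
HB.instance Definition _ := Finite.copy var (can_type bool_of_varK).

Inductive atom :=
| Eq (t u : var)
| Rel1 (R : nat) (t : var)
| Rel2 (R : nat) (t u : var).

Inductive formula :=
| Pos (a : atom)
| Neg (a : atom)
| And (f g : formula)
| Or (f g : formula)
| Forall (v : var) (f : formula)
| Exists (v : var) (W : {set var}) (f : formula).

Definition fr_atom (a : atom) : {set var} :=
  match a with
  | Eq t u => [set t; u]
  | Rel1 _ t => [set t]
  | Rel2 _ t u => [set t; u]
  end.

Fixpoint fr (f : formula) : {set var} :=
  match f with
  | Pos a | Neg a => fr_atom a
  | And f g | Or f g => fr f :|: fr g
  | Forall v f => fr f :\ v
  | Exists v W f => W :|: (fr f :\ v)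
  end.

Definition sentence (f : formula) : Prop := fr f = set0.

(* ** Team semantics *)

Record structure (A : Type) := Structure {
  nonempty : inhabited A;
  rel1 : nat -> A -> Prop;
  rel2 : nat -> A -> A -> Prop
}.

Section Semantics.

Variables (A : Type) (M : structure A).

(* A partial map on the variables; [None] means outside the domain. *)
Definition assignment := {ffun var -> option A}.

Definition dom (s : assignment) : {set var} := [set v | isSome (s v)].

Definition empty_assignment : assignment := [ffun => None].

Definition update (s : assignment) (v : var) (a : A) : assignment :=
  [ffun u => if u == v then Some a else s u].

(* Every team met in evaluating a sentence has a single domain, shared by its
   elements, so that domain can be read off from any of them. *)
Definition team := assignment -> Prop.

Definition supplement (X : team) (F : assignment -> A) (v : var) : team :=
  fun s' => exists s, X s /\ s' = update s v (F s).

Definition duplicate (X : team) (v : var) : team :=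
  fun s' => exists s a, X s /\ s' = update s v a.

(* Only the values of [F] on [X] matter. *)
Definition independent (W : {set var}) (X : team) (F : assignment -> A) : Prop :=
  forall s s', X s -> X s' ->
    (forall v, v \in dom s :\: W -> s v = s' v) -> F s = F s'.

(* The value on atoms with a variable outside the domain of [s] is junk. *)
Definition sat_atom (s : assignment) (a : atom) : Prop :=
  match a with
  | Eq t u => if (s t, s u) is (Some b, Some c) then b = c else False
  | Rel1 R t => if s t is Some b then rel1 M R b else False
  | Rel2 R t u => if (s t, s u) is (Some b, Some c) then rel2 M R b c else False
  end.

Fixpoint sat (X : team) (f : formula) : Prop :=
  match f with
  | Pos a => forall s, X s -> sat_atom s a
  | Neg a => forall s, X s -> ~ sat_atom s a
  | And f g => sat X f /\ sat X g
  | Or f g => exists Y Z : team,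
      [/\ forall s, X s <-> Y s \/ Z s, sat Y f & sat Z g]
  | Forall v f => sat (duplicate X v) f
  | Exists v W f => exists F : assignment -> A,
      independent W X F /\ sat (supplement X F v) f
  end.

Definition truth (f : formula) : Prop := sat (fun s => s = empty_assignment) f.

End Semantics.

(* ** Encoding of formulas: prefix notation, tags and indices in unary *)

Definition enc_nat (n : nat) : word := rcons (nseq n true) false.

Definition enc_var (v : var) : word := [:: v == vy].

Definition enc_atom (a : atom) : word :=
  match a with
  | Eq t u => enc_nat 0 ++ enc_var t ++ enc_var u
  | Rel1 R t => enc_nat 1 ++ enc_nat R ++ enc_var t
  | Rel2 R t u => enc_nat 2 ++ enc_nat R ++ enc_var t ++ enc_var u
  end.

Fixpoint enc (f : formula) : word :=
  match f with
  | Pos a => enc_nat 0 ++ enc_atom a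
  | Neg a => enc_nat 1 ++ enc_atom a
  | And f g => enc_nat 2 ++ enc f ++ enc g
  | Or f g => enc_nat 3 ++ enc f ++ enc g
  | Forall v f => enc_nat 4 ++ enc_var v ++ enc f
  | Exists v W f => enc_nat 5 ++ enc_var v ++ [:: vx \in W; vy \in W] ++ enc f
  end.

Definition FinSat_IF2 : language := fun w =>
  exists f : formula,
    [/\ w = enc f, sentence f
      & exists (A : finType) (M : structure A), truth M f].

(* Main.v *)
From HB Require Import structures.
From mathcomp Require Import all_boot boolp zify.
Require Import Defs.

Set Implicit Arguments.
Unset Strict Implicit.
Unset Printing Implicit Defensive.

(* Membership.  On numbers read as finite sets through their binary digits, the
   team-semantic clauses become bounded arithmetic conditions.  A certificate
   is a finite set of judgments "the formula encoded between two suffixes of the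
   input is true in a given team", each justified by others on shorter formulas;
   the true judgments below a large enough bound form such a set.

   Hardness.  Recursive functions are compiled to combinators on binary trees
   with a single looping construct.  A derivation tree of a terminating run is
   a finite structure whose elements are the steps of the run and the trees they
   mention, and its local consistency amounts to equations between composed
   functions.  The sentence [forall x y (phi(x,y) \/ exists x/{y} psi(x,y))] says
   that each [a] has a [c] serving all [b] at once, and so expresses exactly such
   equations.  The successor map on the iterations of a loop is required to be
   injective and to avoid the first one: in a finite structure every loop ends. *)

(** * Recursive functions *)

(** To compare the ends of two paths from one element, first-order logic needs a third variable.
    Two-variable first-order logic has the finite model property and a decidable satisfiability
    problem, so hardness must come from the slashed quantifier. It occurs only in [functional] and
    [commute]; the rest of the sentence is first-order and, by flatness, is read pointwise. The
    price of the pattern is that its right disjunct sees [c] and [b] but no longer the starting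
    point [a]: the way in which [b] was reached has to be marked by a unary predicate, and this
    shapes several axioms.

    A finite model may contain spurious elements, for instance cyclic trees. They do no harm:
    soundness starts at a single call whose argument represents a genuine tree, and every axiom
    passes genuine trees on to the steps that are reached from there.

    For membership, naming a formula by two suffixes of the input makes parsing and evaluation one
    and the same local check, so no recursion on the syntax has to be programmed as a recursive
    function. *)

Definition recursive (f : seq nat -> nat) :=
  forall n, exists e : recf n, forall v : n.-tuple nat, eval e v (f v).

(** Like [recursive], quantified over all arities: lists serve as de Bruijn environments read with
    default 0, which recursion and bounded quantifiers extend and [behead] shortens, without casts
    between arities. *)
Definition recursive_list (h : seq nat -> seq nat) :=
  forall n, exists k (e : 'I_k -> recf n), forall v : n.-tuple nat,
    exists2 w : k.-tuple nat, h v = w & forall i, eval (e i) v (tnth w i).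

Definition recursiveb (b : seq nat -> bool) := recursive (fun s => b s).

Lemma recursive_ext f g : f =1 g -> recursive f -> recursive g.
Proof. by move=> fg cf n; have [e He] := cf n; exists e => v; rewrite -fg. Qed.

Lemma recursive_list_id : recursive_list id.
Proof. by move=> n; exists n, (@Proj n) => v; exists v. Qed.

Lemma recursive_list_nil : recursive_list (fun=> [::]).
Proof. by move=> n; exists 0, (fun=> Zero n) => v; exists [tuple] => // -[]. Qed.

Lemma recursive_list_behead h : recursive_list h -> recursive_list (fun s => behead (h s)).
Proof.
move=> ch n; have [[|k] [e He]] := ch n.
  exists 0, e => v; have [w -> Hw] := He v; exists w => //.
  by rewrite (tuple0 w).
exists k, (fun i => e (lift ord0 i)) => v; have [w -> Hw] := He v.
exists [tuple of behead w] => // i.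
by have := Hw (lift ord0 i); rewrite !(tnth_nth 0) /= nth_behead.
Qed.

Lemma recursive_list_cons f h : recursive f -> recursive_list h -> recursive_list (fun s =>
  f s :: h s).
Proof.
move=> cf ch n; have [ef Hf] := cf n; have [k [e He]] := ch n.
exists k.+1, (fun i => if unlift ord0 i is Some j then e j else ef) => v.
have [w -> Hw] := He v; exists [tuple of f v :: w] => // i.
case: unliftP => [j|] ->; first by rewrite tnthS.
by rewrite tnth0.
Qed.

Lemma recursive_subst f h : recursive f -> recursive_list h -> recursive (fun s => f (h s)).
Proof.
move=> cf ch n; have [k [e He]] := ch n; have [ef Hf] := cf k.
by exists (Comp ef e) => v /=; have [w -> Hw] := He v; exists w.
Qed.

Lemma recursive_head h : recursive_list h -> recursive (fun s => nth 0 (h s) 0).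
Proof.
move=> ch n; have [[|k] [e He]] := ch n.
  by exists (Zero n) => v; have [w -> Hw] := He v; rewrite (tuple0 w).
by exists (e ord0) => v; have [w -> /(_ ord0)] := He v; rewrite (tnth_nth 0).
Qed.

Lemma recursive_nthS h i : recursive (fun s => nth 0 (behead (h s)) i) ->
  recursive (fun s => nth 0 (h s) i.+1).
Proof. by apply: recursive_ext => s; rewrite nth_behead. Qed.

Lemma recursive_nth h i : recursive_list h -> recursive (fun s => nth 0 (h s) i).
Proof.
elim: i h => [|i IH] h ch; first exact: recursive_head.
exact/recursive_nthS/IH/recursive_list_behead.
Qed.

Lemma recursive_succ f : recursive f -> recursive (fun s => (f s).+1).
Proof.
move=> cf n; have [e He] := cf n.
exists (Comp Succ (fun=> e)) => v; exists [tuple f v]; split=> [i|//].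
by rewrite (ord1 i) tnth0.
Qed.

Lemma recursive_const m : recursive (fun=> m).
Proof.
by elim: m => [|m IH]; [move=> n; exists (Zero n) | exact: recursive_succ].
Qed.

Lemma recursive_rec0 f g : recursive f -> recursive g ->
  recursive (fun s => nat_rect (fun=> nat) (f (behead s))
    (fun k r => g [:: k, r & behead s]) (nth 0 s 0)).
Proof.
move=> cf cg [|n].
  (* On the empty list the counter is the default 0, so only the initial value remains. *)
  by have [e He] := cf 0; exists e => v; have := He v; rewrite (tuple0 v).
have [ef Hf] := cf n; have [eg Hg] := cg n.+2.
exists (Prec ef eg) => v /=; rewrite -[nth 0 v 0]/(nth 0 v (@ord0 n)) -tnth_nth.
rewrite -/(thead v); move: (thead v); set u := [tuple of behead v] => a.
elim: a => [|a IH] /=; first exact: Hf u.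
set r := nat_rect _ _ _ _ in IH *; exists r; split => //.
exact: Hg [tuple of a :: r :: u].
Qed.

(** The form used for all closure properties: the body is a function [G] of counter, previous value
    and environment, and only the hypothesis on [G] sees the first two as entries 0 and 1. *)
Lemma recursive_rec A B (G : nat -> nat -> seq nat -> nat) : recursive A -> recursive B ->
  recursive (fun s => G (nth 0 s 0) (nth 0 s 1) (behead (behead s))) ->
  recursive (fun s => nat_rect (fun=> nat) (B s) (fun k r => G k r s) (A s)).
Proof.
move=> cA cB cG; exact: (recursive_subst (recursive_rec0 cB cG) (recursive_list_cons cA
  recursive_list_id)).
Qed.


Lemma recursive_v0 : recursive (fun s => nth 0 s 0).
Proof. exact: recursive_nth recursive_list_id. Qed.
Lemma recursive_v1 : recursive (fun s => nth 0 s 1).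
Proof. exact: recursive_nth recursive_list_id. Qed.

Lemma recursive_fun2 (F : nat -> nat -> nat) A B :
  recursive (fun s => F (nth 0 s 0) (nth 0 s 1)) -> recursive A -> recursive B ->
  recursive (fun s => F (A s) (B s)).
Proof.
move=> cF cA cB.
exact: (recursive_subst cF (recursive_list_cons cA (recursive_list_cons cB
  recursive_list_nil))).
Qed.

Lemma recursive_add A B : recursive A -> recursive B -> recursive (fun s => A s + B s).
Proof.
move=> cA cB.
apply: recursive_ext (recursive_rec (G := fun _ r _ => r.+1) cA cB (recursive_succ
  recursive_v1)).
by move=> s; elim: (A s) => //= a ->.
Qed.

Lemma recursive_mul A B : recursive A -> recursive B -> recursive (fun s => A s * B s).
Proof.
move=> cA cB; apply: (recursive_fun2 (F := muln)) cA cB.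
have cG : recursive (fun s => nth 0 s 1 + nth 0 (behead (behead s)) 1).
  apply: recursive_add recursive_v1 (recursive_nth 1 _).
  exact: (recursive_list_behead (recursive_list_behead recursive_list_id)).
apply: recursive_ext (recursive_rec (G := fun _ r s => r + nth 0 s 1) recursive_v0
  (recursive_const 0) cG).
by move=> s /=; elim: (nth 0 s 0) => //= a ->; rewrite mulSn addnC.
Qed.

Lemma recursive_pred A : recursive A -> recursive (fun s => (A s).-1).
Proof.
move=> cA.
apply: recursive_ext (recursive_rec (G := fun k _ _ => k) cA (recursive_const 0) recursive_v0).
by move=> s; case: (A s).
Qed.

Lemma recursive_sub A B : recursive A -> recursive B -> recursive (fun s => A s - B s).
Proof.
move=> cA cB.
apply: recursive_ext (recursive_rec (G := fun _ r _ => r.-1) cB cA (recursive_pred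
  recursive_v1)).
by move=> s; elim: (B s) => [|b IH] /=; rewrite ?subn0 // IH subnS.
Qed.

Lemma recursive_exp2 A : recursive A -> recursive (fun s => 2 ^ A s).
Proof.
move=> cA.
apply: recursive_ext (recursive_rec (G := fun _ r _ => 2 * r) cA (recursive_const 1)
  (recursive_mul (recursive_const 2) recursive_v1)).
by move=> s; elim: (A s) => //= a ->; rewrite expnS.
Qed.

Lemma recursiveb_not P : recursiveb P -> recursiveb (fun s => ~~ P s).
Proof.
by move=> cP; apply: recursive_ext (recursive_sub (recursive_const 1) cP) => s; case: (P s).
Qed.

Lemma recursiveb_and P Q : recursiveb P -> recursiveb Q -> recursiveb (fun s => P s && Q s).
Proof.
move=> cP cQ; apply: recursive_ext (recursive_mul cP cQ) => s.
by case: (P s); case: (Q s).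
Qed.

Lemma recursiveb_or P Q : recursiveb P -> recursiveb Q -> recursiveb (fun s => P s || Q s).
Proof.
move=> cP cQ; have := recursiveb_not (recursiveb_and (recursiveb_not cP) (recursiveb_not cQ)).
by apply: recursive_ext => s; case: (P s); case: (Q s).
Qed.

Lemma recursiveb_imp P Q : recursiveb P -> recursiveb Q -> recursiveb (fun s => P s ==> Q s).
Proof.
move=> cP cQ; apply: recursive_ext (recursiveb_or (recursiveb_not cP) cQ) => s.
by case: (P s); case: (Q s).
Qed.

Lemma recursiveb_eq0 A : recursive A -> recursiveb (fun s => A s == 0).
Proof.
move=> cA; apply: recursive_ext (recursive_sub (recursive_const 1) cA) => s.
by case: (A s).
Qed.

Lemma recursiveb_leq A B : recursive A -> recursive B -> recursiveb (fun s => A s <= B s).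
Proof. by move=> cA cB; exact/recursiveb_eq0/recursive_sub. Qed.

Lemma recursiveb_eqn A B : recursive A -> recursive B -> recursiveb (fun s => A s == B s).
Proof.
move=> cA cB; apply: recursive_ext (recursiveb_and (recursiveb_leq cA cB) (recursiveb_leq
  cB cA)).
by move=> s; rewrite eqn_leq.
Qed.

Lemma recursiveb_eqb P Q : recursiveb P -> recursiveb Q -> recursiveb (fun s => P s == Q s).
Proof.
move=> cP cQ; apply: recursive_ext (recursiveb_eqn cP cQ) => s.
by case: (P s); case: (Q s).
Qed.

Lemma recursive_if P A B : recursiveb P -> recursive A -> recursive B ->
  recursive (fun s => if P s then A s else B s).
Proof.
move=> cP cA cB.
apply: recursive_ext (recursive_add (recursive_mul cP cA) (recursive_mul (recursiveb_not
  cP) cB)) => s.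
by case: (P s); lia.
Qed.

Lemma recursiveb_odd A : recursive A -> recursiveb (fun s => odd (A s)).
Proof.
move=> cA.
apply: recursive_ext (recursive_rec (G := fun _ r _ => 1 - r) cA (recursive_const 0)
  (recursive_sub (recursive_const 1) recursive_v1)).
by move=> s; elim: (A s) => //= a ->; case: odd.
Qed.

Lemma recursive_half A : recursive A -> recursive (fun s => (A s)./2).
Proof.
move=> cA.
apply: recursive_ext (recursive_rec (G := fun k r _ => odd k + r) cA (recursive_const 0)
  (recursive_add (recursiveb_odd recursive_v0) recursive_v1)).
by move=> s; elim: (A s) => //= a ->; rewrite uphalf_half.
Qed.

Definition bit c j := odd (c %/ 2 ^ j).

Lemma recursiveb_bit A B : recursive A -> recursive B -> recursiveb (fun s => bit (A s) (B s)).
Proof.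
move=> cA cB; have := recursiveb_odd (recursive_rec (G := fun _ r _ => r./2) cB cA
  (recursive_half recursive_v1)).
apply: recursive_ext => s; congr (nat_of_bool (odd _)).
elim: (B s) => [|b IH] /=; first by rewrite divn1.
by rewrite IH expnSr divnMA divn2.
Qed.

(** * Bounded quantifiers *)

Definition alb n (P : nat -> bool) := all P (iota 0 n.+1).
Definition exb n (P : nat -> bool) := has P (iota 0 n.+1).

Lemma albP n (P : nat -> bool) : reflect (forall i, i <= n -> P i) (alb n P).
Proof. by apply: (iffP allP) => H i; have := H i; rewrite mem_iota. Qed.

Lemma exbP n (P : nat -> bool) : reflect (exists2 i, i <= n & P i) (exb n P).
Proof. by apply: (iffP hasP) => -[i Hi Pi]; exists i; rewrite ?mem_iota // in Hi *. Qed.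

(** The conjunction is a product of values 0 and 1, computed by recursion on the bound; the bound
    variable is entry 0 of the environment of [P]. *)
Lemma recursiveb_alb A (P : nat -> seq nat -> bool) : recursive A ->
  recursiveb (fun s => P (nth 0 s 0) (behead s)) ->
  recursiveb (fun s => alb (A s) (fun i => P i s)).
Proof.
move=> cA cP.
have cG : recursive (fun s => nth 0 s 1 * P (nth 0 s 0) (behead (behead s))).
  apply: recursive_mul recursive_v1 _.
  exact: (recursive_subst cP (recursive_list_cons recursive_v0 (recursive_list_behead
    (recursive_list_behead recursive_list_id)))).
apply: recursive_ext (recursive_rec (G := fun k r s => r * P k s) (recursive_succ cA)
  (recursive_const 1) cG).
move=> s; rewrite /alb; elim: (A s).+1 => // a IH.
rewrite -[in RHS]addn1 iotaD all_cat /= {}IH andbT.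
by case: all; case: (P a s).
Qed.

Lemma recursiveb_exb A (P : nat -> seq nat -> bool) : recursive A ->
  recursiveb (fun s => P (nth 0 s 0) (behead s)) ->
  recursiveb (fun s => exb (A s) (fun i => P i s)).
Proof.
move=> cA cP; have := recursiveb_not (recursiveb_alb (P := fun i s => ~~ P i s) cA
  (recursiveb_not cP)).
apply: recursive_ext => s; rewrite /alb /exb -has_predC; congr nat_of_bool.
by apply: eq_has => i /=; rewrite negbK.
Qed.

(** * Certificates as numbers *)

(** A polynomial that is monotone in both arguments. It is injective because the summand [a] is too
    small to reach the next square after that of [a + b]. *)
Definition pair_num a b := (a + b) * (a + b) + a.

Lemma pair_num_inj a b a' b' : pair_num a b = pair_num a' b' -> a = a' /\ b = b'.
Proof.
rewrite /pair_num => E; suff Es : a + b = a' + b' by move: E; rewrite Es; lia.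
by case: (ltngtP (a + b) (a' + b')) => // ?; nia.
Qed.

Lemma pair_num_le a b : a <= pair_num a b /\ b <= pair_num a b.
Proof. by rewrite /pair_num; nia. Qed.

Lemma pair_num_mono a b a' b' : a <= a' -> b <= b' -> pair_num a b <= pair_num a' b'.
Proof. by rewrite /pair_num; nia. Qed.

Lemma bit_lt c j : bit c j -> j < c.
Proof.
rewrite /bit; case: (ltnP j c) => // cj.
by rewrite divn_small //; apply: leq_ltn_trans cj (ltn_expl _ _).
Qed.

(** Finite comprehension: it turns teams, relations and choice functions of a finite structure into
    numbers. [P] is an arbitrary proposition, decided classically at each position. *)
Lemma bitmask N (P : nat -> Prop) :
  exists2 x, x < 2 ^ N & forall j, bit x j <-> j < N /\ P j.
Proof.
elim: N => [|N [x xN Hx]]; first by exists 0 => // j; rewrite /bit div0n; split=> // -[].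
have xN' j : j < N -> bit (2 ^ N + x) j = bit x j.
  move=> jN; rewrite /bit divnDl ?dvdn_exp2l ?(ltnW jN) //.
  rewrite -expnB // ?oddD ?(ltnW jN) // oddX subn_eq0 leqNgt jN //.
have [pN|pN] := pselect (P N); last first.
  exists x; first by rewrite expnS; lia.
  move=> j; apply: (iff_trans (Hx j)); split=> -[jN Pj]; split=> //; first lia.
  by move: jN; rewrite ltnS leq_eqVlt => /orP[/eqP E|//]; case: pN; rewrite -E.
exists (2 ^ N + x); first by rewrite expnS; lia.
move=> j; case: (ltngtP j N) => jN.
- by rewrite xN' // Hx; split=> -[? ?]; split=> //; lia.
- rewrite /bit divn_small; first by split=> // -[]; lia.
  by apply: (@leq_trans (2 ^ N.+1)); [rewrite expnS; lia | rewrite leq_exp2l].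
- rewrite jN /bit divnDl // divnn expn_gt0 /= divn_small // addn0.
Qed.

Lemma word_num_cons b w : word_num (b :: w) = 2 * word_num w + b + 1.
Proof. by rewrite /= -mul2n addnS addn1. Qed.

Lemma word_num_inj : injective word_num.
Proof.
elim=> [|b w IH] [|b' w'] //=; try lia.
move=> E; have [-> /IH ->] // : b = b' /\ word_num w = word_num w'.
by case: b b' E => [] []; lia.
Qed.

Lemma word_num_onto k : exists w, word_num w = k.
Proof.
elim/ltn_ind: k => -[|k] IH; first by exists [::].
have [w Hw] := IH k./2 ltac:(lia); exists (odd k :: w).
by rewrite word_num_cons Hw -[in RHS](odd_double_half k); lia.
Qed.

(** Prefixing [true] sends [t] to [2 * t + 2], that is, doubles [t + 2], while the closing [false]
    sends [t] to [2 * t + 1]; this gives the closed form. *)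
Definition cons_nat k t := 2 ^ k * (2 * t + 3) - 2.
Definition cons_bit v t := 2 * t + v + 1.
Definition var_bit v : nat := bool_of_var v.

Lemma word_num_nat k w : word_num (enc_nat k ++ w) = cons_nat k (word_num w).
Proof.
elim: k => [|k IH]; first by rewrite word_num_cons /cons_nat; lia.
rewrite /enc_nat /= -/(enc_nat k) -[RHS]/(cons_nat k.+1 (word_num w)).
have := word_num_cons true (enc_nat k ++ w); rewrite /= => ->.
rewrite IH /cons_nat expnS; have := expn_gt0 2 k; nia.
Qed.

Lemma word_num_var v w : word_num (enc_var v ++ w) = cons_bit (var_bit v) (word_num w).
Proof.
rewrite /cons_bit /var_bit /enc_var cat1s word_num_cons.
by have -> : (v == vy) = bool_of_var v by case: v.
Qed.

Lemma cons_nat_ge k t : k <= cons_nat k t.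
Proof. by rewrite /cons_nat; have := ltn_expl k (isT : 1 < 2); nia. Qed.

Lemma cons_nat_gt k t : t < cons_nat k t.
Proof. by rewrite /cons_nat; have := expn_gt0 2 k; nia. Qed.

Lemma cons_bit_gt v t : t < cons_bit v t.
Proof. by rewrite /cons_bit; lia. Qed.

Lemma word_num_cat v w : word_num w <= word_num (v ++ w).
Proof. by elim: v => //= b v IH; lia. Qed.

(** An assignment is a pair of numbers at most [n]: 0 for a variable outside the domain and [i.+1]
    for element number [i]. Hence the tests [0 <] below. *)
Definition sel_var (v a b : nat) : nat := if v == 0 then a else b.
Definition upd (v e a b : nat) : nat := if v == 0 then pair_num e b else pair_num a e.
Definition sat_eq t v a b := (0 < sel_var t a b) && (sel_var t a b == sel_var v a b).
Definition sat_rel1 r R t a b := (0 < sel_var t a b) && bit r (pair_num R (sel_var t a b)).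
Definition sat_rel2 r R t v a b :=
  [&& 0 < sel_var t a b, 0 < sel_var v a b & bit r (pair_num R (pair_num (sel_var t a b)
    (sel_var v a b)))].

Definition literal n x p (P : nat -> nat -> bool) :=
  alb n (fun a => alb n (fun b => bit x (pair_num a b) ==> (P a b == (p == 0)))).

(** The sign [p] is also the tag of the literal in the encoding: 0 for [Pos], 1 for [Neg]. *)
Definition step_atom n r1 r2 u s s' x dx dy :=
  exb 1 (fun p => exb 1 (fun t => (0 < sel_var t dx dy) && (
    exb 1 (fun v => (0 < sel_var v dx dy) && (
      (s == cons_nat p (cons_nat 0 (cons_bit t (cons_bit v s')))) && literal n x p (sat_eq t v)
      || exb u (fun R => (s == cons_nat p (cons_nat 2 (cons_nat R (cons_bit t (cons_bit v
        s')))))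
                 && literal n x p (sat_rel2 r2 R t v))))
    || exb u (fun R => (s == cons_nat p (cons_nat 1 (cons_nat R (cons_bit t s'))))
                 && literal n x p (sat_rel1 r1 R t))))).

(** Arguments [s s' x dx dy]: word number [s] is a formula followed by word number [s'], true in the
    team [x], with free variables among those flagged by [dx] and [dy]. The flags are separate
    because an empty team does not show its domain. *)
Definition judgment := nat -> nat -> nat -> nat -> nat -> bool.

Definition step_and u (J : judgment) s s' x dx dy :=
  exb u (fun m => exb u (fun s1 =>
    [&& s == cons_nat 2 s1, J s1 m x dx dy & J m s' x dx dy])).

Definition step_or n u (J : judgment) s s' x dx dy :=
  exb u (fun m => exb u (fun s1 => exb u (fun y => exb u (fun z =>
    [&& s == cons_nat 3 s1,
        alb n (fun a => alb n (fun b =>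
          bit x (pair_num a b) == bit y (pair_num a b) || bit z (pair_num a b))),
        J s1 m y dx dy & J m s' z dx dy])))).

(** The team [y] is described from its elements: [v] has a value, and putting back some old value
    [e] of [v], with 0 for undefined, gives an element of [x]. *)
Definition step_forall n u (J : judgment) s s' x dx dy :=
  exb 1 (fun v => exb u (fun s1 => exb u (fun y =>
    [&& s == cons_nat 4 (cons_bit v s1),
        alb n (fun a => alb n (fun b => bit y (pair_num a b) ==
          (0 < sel_var v a b) && exb n (fun e => bit x (upd v e a b))))
      & J s1 s' y (if v == 0 then 1 else dx) (if v == 0 then dy else 1)]))).

(** [G] is the graph of the choice function on [x]. The second conjunct is independence; applied to
    two equal assignments it also says that [G] is single-valued. *)
Definition choice_graph n x G wx wy :=
  alb n (fun a => alb n (fun b => bit x (pair_num a b) ==>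
    exb n (fun c => (0 < c) && bit G (pair_num (pair_num a b) c))
    && alb n (fun a' => alb n (fun b' => bit x (pair_num a' b') ==>
      ((0 < a) && (wx == 0) ==> (a == a')) ==>
      ((0 < b) && (wy == 0) ==> (b == b')) ==>
      alb n (fun c => alb n (fun c' => (0 < c) ==> (0 < c') ==> bit G (pair_num (pair_num a
        b) c) ==>
        bit G (pair_num (pair_num a' b') c') ==> (c == c'))))))).

Definition step_exists n u (J : judgment) s s' x dx dy :=
  exb 1 (fun v => exb 1 (fun wx => exb 1 (fun wy =>
  exb u (fun s1 => exb u (fun y => exb u (fun G =>
    [&& s == cons_nat 5 (cons_bit v (cons_bit wx (cons_bit wy s1))),
        (0 < wx) ==> (0 < dx), (0 < wy) ==> (0 < dy),
        choice_graph n x G wx wy,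
        alb n (fun a => alb n (fun b => bit y (pair_num a b) ==
          (0 < sel_var v a b) && exb n (fun e =>
             bit x (upd v e a b) && bit G (pair_num (upd v e a b) (sel_var v a b)))))
      & J s1 s' y (if v == 0 then 1 else dx) (if v == 0 then dy else 1)])))))).

Definition step n r1 r2 u (J : judgment) s s' x dx dy :=
  [|| step_atom n r1 r2 u s s' x dx dy, step_and u J s s' x dx dy,
      step_or n u J s s' x dx dy, step_forall n u J s s' x dx dy
    | step_exists n u J s s' x dx dy].

Definition recorded c : judgment := fun s s' x dx dy =>
  bit c (pair_num s (pair_num s' (pair_num x (pair_num dx dy)))).

Definition certificate u w :=
  exb u (fun n => exb u (fun r1 => exb u (fun r2 => exb u (fun c => exb u (fun x0 =>
    [&& 0 < n,
      alb u (fun s => alb u (fun s' => alb u (fun x => alb u (fun dx => alb u (fun dy =>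
        recorded c s s' x dx dy ==> step n r1 r2 u (recorded c) s s' x dx dy))))),
      recorded c w 0 x0 0 0
    & alb n (fun a => alb n (fun b => bit x0 (pair_num a b) == (a == 0) && (b == 0)))]))))).

Ltac recursive_step := cbv beta; lazymatch goal with
  | |- recursive_list (fun s => s) => exact: recursive_list_id
  | |- recursive_list (@behead nat) => exact: (recursive_list_behead recursive_list_id)
  | |- recursive_list (fun s => behead _) => apply: recursive_list_behead
  | |- recursive (fun s => nth 0 _ _) => apply: recursive_nth
  | |- recursiveb (fun s => exb _ _) => apply: recursiveb_exb
  | |- recursiveb (fun s => alb _ _) => apply: recursiveb_alb
  | |- recursiveb (fun s => _ && _) => apply: recursiveb_and
  | |- recursiveb (fun s => _ || _) => apply: recursiveb_or
  | |- recursiveb (fun s => _ ==> _) => apply: recursiveb_imp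
  | |- recursiveb (fun s => bit _ _) => apply: recursiveb_bit
  | |- recursiveb (fun s => _ < _) => apply: recursiveb_leq
  | |- recursiveb (fun s => @eq_op Datatypes_nat__canonical__eqtype_Equality _ _) => apply:
    recursiveb_eqn
  | |- recursiveb (fun s => @eq_op Datatypes_bool__canonical__eqtype_Equality _ _) =>
    apply: recursiveb_eqb
  | |- recursive (fun s => if _ then _ else _) => apply: recursive_if
  | |- recursive (fun s => _ + _) => apply: recursive_add
  | |- recursive (fun s => _ * _) => apply: recursive_mul
  | |- recursive (fun s => _ - _) => apply: recursive_sub
  | |- recursive (fun s => 2 ^ _) => apply: recursive_exp2
  | |- recursive (fun s => ?m) => exact: recursive_const
  | |- recursive (fun s => _.+1) => apply: recursive_succ
  end.
Ltac recursive_auto := repeat recursive_step.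

Lemma recursiveb_certificate : recursiveb (fun s => certificate (nth 0 s 0) (nth 0 s 1)).
Proof.
rewrite /certificate /step /step_atom /step_and /step_or /step_forall /step_exists.
rewrite /literal /choice_graph /recorded /sat_eq /sat_rel1 /sat_rel2 /sel_var /upd
  /cons_nat /cons_bit /pair_num.
recursive_auto.
Qed.

Lemma exb_var (P : nat -> bool) : exb 1 P <-> exists v : var, P (var_bit v).
Proof.
split=> [/exbP[[|[|//]] _ Pi]|[v Pv]]; [by exists vx|by exists vy|].
by apply/exbP; exists (var_bit v) => //; case: (v).
Qed.

Lemma exb_bool (P : nat -> bool) : exb 1 P <-> exists b : bool, P b.
Proof.
split=> [/exbP[[|[|//]] _ Pi]|[b Pb]]; [by exists false|by exists true|].
by apply/exbP; exists (b : nat) => //; case: (b).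
Qed.

Lemma sel_var_map (T : Type) (h : T -> nat) (g : var -> T) v :
  sel_var (var_bit v) (h (g vx)) (h (g vy)) = h (g v).
Proof. by case: v. Qed.

Definition Dset dx dy : {set var} := [set v | 0 < sel_var (var_bit v) dx dy].

Lemma Dset_add v dx dy :
  Dset (if var_bit v == 0 then 1 else dx) (if var_bit v == 0 then dy else 1) = v |: Dset dx dy.
Proof. by apply/setP => u; rewrite !inE; case: u; case: v. Qed.

Lemma sub_setD1 (B D : {set var}) v : (B :\ v \subset D) = (B \subset v |: D).
Proof. by rewrite subDset. Qed.

Definition signed_atom p a := if p == 0 then Pos a else Neg a.

Lemma fr_lit p a : fr (signed_atom p a) = fr_atom a.
Proof. by rewrite /signed_atom; case: eqP. Qed.

Lemma enc_lit (p : bool) a : enc (signed_atom p a) = enc_nat p ++ enc_atom a.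
Proof. by case: p. Qed.

(** Indices are written in unary, so a symbol occurring in a word is at most the number of that
    word. This bounds the search for [R] and the symbols that a certificate has to record. *)
Lemma cons_nat3_ge p k R t : R <= cons_nat p (cons_nat k (cons_nat R t)).
Proof. exact/(leq_trans (cons_nat_ge R t))/ltnW/(ltn_trans (cons_nat_gt k _))/cons_nat_gt. Qed.

(** * Judgments read in a finite structure *)

Section Meaning.

Variables (A : finType) (M : structure A) (rho : A -> nat) (n r1 r2 : nat).
Hypothesis rho_inj : injective rho.
Hypothesis rho_lt : forall a, rho a < n.
Hypothesis rho_onto : forall i, i < n -> exists a, rho a = i.

Definition code (o : option A) := if o is Some a then (rho a).+1 else 0.
Definition code_asg (s : assignment A) := pair_num (code (s vx)) (code (s vy)).
Definition decode x : team A := fun s => bit x (code_asg s).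

(** Stated symbol by symbol: a given infinite structure of relations can be matched by the finitely
    many digits of [r1] and [r2] only on a bounded set of symbols. *)
Definition agree R :=
  (forall a, rel1 M R a <-> bit r1 (pair_num R (rho a).+1)) /\
  (forall a b, rel2 M R a b <-> bit r2 (pair_num R (pair_num (rho a).+1 (rho b).+1))).

Lemma code_le o : code o <= n.
Proof. by case: o => //= a; apply: rho_lt. Qed.

Lemma code_inj : injective code.
Proof. by case=> [a|] [b|] //= [/rho_inj ->]. Qed.

Lemma code_onto i : i <= n -> exists o, code o = i.
Proof.
by case: i => [_|i /rho_onto[a <-]]; [exists None | exists (Some a)].
Qed.

Lemma code_asg_inj : injective code_asg.
Proof.
move=> s s' /pair_num_inj[/code_inj Ex /code_inj Ey].
by apply/ffunP => -[].
Qed.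

Lemma code_asg_le s : code_asg s <= pair_num n n.
Proof. exact: pair_num_mono (code_le _) (code_le _). Qed.

Lemma alb_asg (Q : nat -> nat -> bool) :
  alb n (fun a => alb n (fun b => Q a b)) <->
  forall s : assignment A, Q (code (s vx)) (code (s vy)).
Proof.
split=> [/albP H s|H]; first by have /albP := H _ (code_le (s vx)); apply; apply: code_le.
apply/albP => a /code_onto[o <-]; apply/albP => b /code_onto[o' <-].
by have := H [ffun v => if v is vx then o else o']; rewrite !ffunE.
Qed.

Lemma exb_code (Q : nat -> bool) : exb n Q <-> exists o, Q (code o).
Proof.
split=> [/exbP[i /code_onto[o <-] Qi]|[o Qo]]; first by exists o.
by apply/exbP; exists (code o); rewrite ?code_le.
Qed.

Lemma encode_team (X : team A) : exists2 x, x < 2 ^ (pair_num n n).+1 & decode x = X.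
Proof.
have [x xN Hx] := bitmask (pair_num n n).+1 (fun j => exists2 s, j = code_asg s & X s).
exists x => //; apply/funext => s; apply/propext; rewrite /decode; split.
  by move/Hx => [_ [s' /code_asg_inj <-]].
by move=> Xs; apply/Hx; split; [rewrite ltnS code_asg_le | exists s].
Qed.

Definition derivable s s' x dx dy := exists f w,
  [/\ s = word_num (enc f ++ w), s' = word_num w,
      fr f \subset Dset dx dy & sat M (decode x) f].

Lemma literalP p x a (P : nat -> nat -> bool) :
  (forall s : assignment A, P (code (s vx)) (code (s vy)) <-> sat_atom M s a) ->
  literal n x p P <-> sat M (decode x) (signed_atom p a).
Proof.
move=> HP; rewrite /literal alb_asg /signed_atom; case: (p == 0) => /=.
  split=> H s; first by move=> xs; have /implyP/(_ xs)/eqP := H s; rewrite -HP.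
  by apply/implyP => xs; apply/eqP; apply/HP/H.
split=> H s.
  by move=> xs; have /implyP/(_ xs) := H s; rewrite eqbF_neg -HP => /negP.
by apply/implyP => xs; rewrite eqbF_neg; apply/negP => /HP; apply: H.
Qed.

Lemma sel_varE t (s : assignment A) :
  sel_var (var_bit t) (code (s vx)) (code (s vy)) = code (s t).
Proof. exact: (sel_var_map code s). Qed.

Lemma sat_eqP t v (s : assignment A) : sat_eq (var_bit t) (var_bit v) (code (s vx)) (code
  (s vy))
  <-> sat_atom M s (Eq t v).
Proof.
rewrite /sat_eq !sel_varE /=; case: (s t) (s v) => [a|] [b|] //=.
by rewrite eqSS; split=> [/eqP/rho_inj|->].
Qed.

Lemma sat_rel1P R t (s : assignment A) : agree R ->
  sat_rel1 r1 R (var_bit t) (code (s vx)) (code (s vy)) <-> sat_atom M s (Rel1 R t).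
Proof. by case=> ag _; rewrite /sat_rel1 sel_varE /=; case: (s t) => [a|]; rewrite //= ag. Qed.

Lemma sat_rel2P R t v (s : assignment A) : agree R ->
  sat_rel2 r2 R (var_bit t) (var_bit v) (code (s vx)) (code (s vy)) <->
  sat_atom M s (Rel2 R t v).
Proof.
case=> _ ag; rewrite /sat_rel2 !sel_varE /=.
by case: (s t) (s v) => [a|] [b|]; rewrite //= ag.
Qed.

(** Undoes an [update]; the value is an option since the variable may have been undefined before. *)
Definition override (s : assignment A) v o : assignment A :=
  [ffun u => if u == v then o else s u].

Lemma override_update (s : assignment A) v o a : s v = Some a -> update (override s v o) v
  a = s.
Proof. by move=> sv; apply/ffunP => u; rewrite !ffunE; case: eqP => // ->. Qed.

Lemma override_self (s : assignment A) v a : override (update s v a) v (s v) = s.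
Proof. by apply/ffunP => u; rewrite !ffunE; case: eqP => // ->. Qed.

Lemma code_override (s : assignment A) v o : upd (var_bit v) (code o) (code (s vx)) (code
  (s vy)) =
  code_asg (override s v o).
Proof. by case: v; rewrite /code_asg !ffunE. Qed.

Lemma duplicate_team x y v :
  alb n (fun a => alb n (fun b => bit y (pair_num a b) ==
          (0 < sel_var (var_bit v) a b) && exb n (fun e => bit x (upd (var_bit v) e a b)))) <->
  decode y = duplicate (decode x) v.
Proof.
rewrite alb_asg; have H (s : assignment A) : (0 < sel_var (var_bit v) (code (s vx)) (code
  (s vy))) &&
    exb n (fun e => bit x (upd (var_bit v) e (code (s vx)) (code (s vy))))
    <-> duplicate (decode x) v s.
  rewrite sel_varE; split.
    case Es: (s v) => [a|] //= /exb_code[o Ho]; exists (override s v o), a.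
    by rewrite override_update //; split=> //; rewrite /decode -code_override.
  case=> s1 [a [Xs1 ->]]; rewrite ffunE eqxx /=; apply/exb_code; exists (s1 v).
  by rewrite code_override override_self.
split=> [E|E s].
  by apply/funext => s; apply/propext; rewrite -H /decode (eqP (E s)).
by move: (H s); rewrite -E /decode /code_asg => Hs; apply/eqP; apply/idP/idP => /Hs.
Qed.

Lemma union_team x y z :
  alb n (fun a => alb n (fun b =>
    bit x (pair_num a b) == bit y (pair_num a b) || bit z (pair_num a b))) <->
  forall s, decode x s <-> decode y s \/ decode z s.
Proof.
rewrite alb_asg; split=> H s; first by rewrite /decode (eqP (H s)); split=> /orP.
by apply/eqP; apply/idP/idP => [/(H s)/orP|/orP/(H s)].
Qed.

Definition graph G x (F : assignment A -> A) := forall s a, decode x s ->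
  bit G (pair_num (code_asg s) (rho a).+1) <-> F s = a.

Lemma encode_graph x F : exists2 G, G < 2 ^ (pair_num (pair_num n n) n).+1 & graph G x F.
Proof.
have [G GN HG] := bitmask (pair_num (pair_num n n) n).+1
  (fun j => exists s, j = pair_num (code_asg s) (rho (F s)).+1).
exists G => // s a _; split.
  by move/HG => [_ [s' /pair_num_inj[/code_asg_inj <- [/rho_inj ->]]]].
move=> <-; apply/HG; split; last by exists s.
by rewrite ltnS; apply: pair_num_mono (code_asg_le s) (rho_lt _).
Qed.

Lemma choice_graphP x G wx wy (W : {set var}) F :
  (forall v, (v \in W) = (0 < sel_var (var_bit v) wx wy)) -> graph G x F ->
  choice_graph n x G wx wy <-> independent W (decode x) F.
Proof.
move=> HW HG; rewrite /choice_graph alb_asg.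
have agreeE (s s' : assignment A) : (forall v, v \in dom s :\: W -> s v = s' v) <->
    ((0 < code (s vx)) && (wx == 0) ==> (code (s vx) == code (s' vx))) &&
    ((0 < code (s vy)) && (wy == 0) ==> (code (s vy) == code (s' vy))).
  rewrite !(inj_eq code_inj); split=> [H|/andP[Hx Hy] v].
    apply/andP; split; apply/implyP => /andP[s0 w0]; apply/eqP/H.
      by rewrite !inE HW /= (eqP w0) /=; case: (s vx) s0.
    by rewrite !inE HW /= (eqP w0) /=; case: (s vy) s0.
  rewrite !inE HW /sel_var /var_bit => /andP[]; rewrite -leqNgt leqn0.
  by case: v => /= [/eqP w0|/eqP w0]; move: Hx Hy; rewrite w0 eqxx andbT;
    [case: (s vx)|case: (s vy)] => //= a; [move=> + _|move=> _] => /eqP.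
have valueE (s s' : assignment A) : decode x s -> decode x s' ->
    alb n (fun c => alb n (fun c' => (0 < c) ==> (0 < c') ==>
      bit G (pair_num (code_asg s) c) ==> bit G (pair_num (code_asg s') c') ==> (c == c')))
    <-> F s = F s'.
  move=> Xs Xs'; split=> [/albP H|E].
    have /albP/(_ _ (rho_lt (F s'))) := H _ (rho_lt (F s)).
    have [_ ->] // := HG s (F s) Xs; have [_ ->] // := HG s' (F s') Xs'.
    by rewrite /= eqSS => /eqP/rho_inj.
  apply/albP => _ /code_onto[[a|] <-]; apply/albP => _ /code_onto[[b|] <-] //.
  apply/implyP => _; apply/implyP => _; apply/implyP => /(HG s a Xs) Ha.
  by apply/implyP => /(HG s' b Xs') Hb; rewrite -Ha -Hb E.
split=> [H s s' Xs Xs' E|H s].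
  have /implyP/(_ Xs)/andP[_ /alb_asg/(_ s')/implyP/(_ Xs')] := H s.
  by have /andP[-> ->] := (agreeE s s').1 E; move/(valueE _ _ Xs Xs').
apply/implyP => Xs; apply/andP; split.
  apply/exb_code; exists (Some (F s)) => /=.
  by have [_ ->] := HG s (F s) Xs.
apply/alb_asg => s'; apply/implyP => Xs'.
apply/implyP => Ex; apply/implyP => Ey; apply/(valueE _ _ Xs Xs').
by apply: H => //; apply/agreeE; rewrite Ex Ey.
Qed.

(** Totality gives a value at each assignment of the team, and the independence clause with both
    assignments equal makes it unique; outside the team [F] takes the default [a0]. *)
Lemma choice_graph_fun x G wx wy :
  choice_graph n x G wx wy -> exists F, graph G x F.
Proof.
move=> /alb_asg H; have [a0] := nonempty M.
have ex (s : assignment A) : exists a, decode x s -> forall b,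
    bit G (pair_num (code_asg s) (rho b).+1) <-> a = b.
  have [Xs|nX] := pselect (decode x s); last by exists a0 => /nX.
  have /implyP/(_ Xs)/andP[/exb_code[[a|//] /= Ga] /alb_asg/(_ s)] := H s.
  move=> /implyP/(_ Xs); rewrite !eqxx !implybT /= => /albP K.
  exists a => _ b; split=> [Gb|<- //].
  have /albP/(_ _ (rho_lt b)) := K _ (rho_lt a).
  by rewrite /= Ga Gb eqSS /= => /eqP/rho_inj.
by have [F HF] := choice ex; exists F => s a /HF.
Qed.

Lemma supplement_team x y v G F : graph G x F ->
  alb n (fun a => alb n (fun b => bit y (pair_num a b) ==
          (0 < sel_var (var_bit v) a b) && exb n (fun e =>
             bit x (upd (var_bit v) e a b) && bit G (pair_num (upd (var_bit v) e a b)
               (sel_var (var_bit v) a b))))) <->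
  decode y = supplement (decode x) F v.
Proof.
move=> HG; rewrite alb_asg.
have H (s : assignment A) : (0 < sel_var (var_bit v) (code (s vx)) (code (s vy))) &&
    exb n (fun e => bit x (upd (var_bit v) e (code (s vx)) (code (s vy))) &&
      bit G (pair_num (upd (var_bit v) e (code (s vx)) (code (s vy)))
                (sel_var (var_bit v) (code (s vx)) (code (s vy)))))
    <-> supplement (decode x) F v s.
  rewrite sel_varE; split.
    case Es: (s v) => [a|] //= /exb_code[o]; rewrite code_override => /andP[Xo Go].
    exists (override s v o); split=> //.
    by have /(_ Go) -> := (HG (override s v o) a Xo).1; rewrite override_update.
  case=> s1 [Xs1 ->]; rewrite ffunE eqxx /=; apply/exb_code; exists (s1 v).
  rewrite code_override override_self Xs1 /=.
  by have [_ ->] := HG s1 (F s1) Xs1.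
split=> [E|E s].
  by apply/funext => s; apply/propext; rewrite -H /decode (eqP (E s)).
by move: (H s); rewrite -E /decode /code_asg => Hs; apply/eqP; apply/idP/idP => /Hs.
Qed.

Lemma enc_lit_num (p : bool) a w :
  word_num (enc (signed_atom p a) ++ w) = cons_nat p (match a with
    | Eq t v => cons_nat 0 (cons_bit (var_bit t) (cons_bit (var_bit v) (word_num w)))
    | Rel1 R t => cons_nat 1 (cons_nat R (cons_bit (var_bit t) (word_num w)))
    | Rel2 R t v => cons_nat 2 (cons_nat R (cons_bit (var_bit t) (cons_bit (var_bit v)
      (word_num w)))) end).
Proof.
by rewrite enc_lit; case: a => *; rewrite /enc_atom -!catA !(word_num_nat, word_num_var).
Qed.

Lemma enc_set_num (W : {set var}) w :
  word_num ([:: vx \in W; vy \in W] ++ w) = cons_bit (vx \in W) (cons_bit (vy \in W)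
    (word_num w)).
Proof. by rewrite /cons_bit -!word_num_cons. Qed.

Lemma enc_and_num f g w :
  word_num (enc (And f g) ++ w) = cons_nat 2 (word_num (enc f ++ enc g ++ w)).
Proof. by rewrite -word_num_nat /= -?catA. Qed.

Lemma enc_or_num f g w :
  word_num (enc (Or f g) ++ w) = cons_nat 3 (word_num (enc f ++ enc g ++ w)).
Proof. by rewrite -word_num_nat /= -?catA. Qed.

Lemma enc_forall_num v f w :
  word_num (enc (Forall v f) ++ w) = cons_nat 4 (cons_bit (var_bit v) (word_num (enc f ++ w))).
Proof. by rewrite -word_num_var -word_num_nat /= -?catA. Qed.

Lemma enc_exists_num v W f w : word_num (enc (Exists v W f) ++ w) =
  cons_nat 5 (cons_bit (var_bit v) (cons_bit (vx \in W) (cons_bit (vy \in W) (word_num (enc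
    f ++ w))))).
Proof. by rewrite -enc_set_num -word_num_var -word_num_nat /= -?catA. Qed.

Lemma fr_atom_sub a dx dy : (fr_atom a \subset Dset dx dy) =
  match a with
  | Eq t v | Rel2 _ t v => (0 < sel_var (var_bit t) dx dy) && (0 < sel_var (var_bit v) dx dy)
  | Rel1 _ t => 0 < sel_var (var_bit t) dx dy
  end.
Proof. by case: a => *; rewrite /= ?subUset !sub1set !inE. Qed.

Lemma step_atomP u s s' x dx dy : (forall R, R <= s -> agree R) ->
  step_atom n r1 r2 u s s' x dx dy ->
  exists (p : bool) a, [/\ forall w, s' = word_num w -> s = word_num (enc (signed_atom p a)
    ++ w),
    fr_atom a \subset Dset dx dy & sat M (decode x) (signed_atom p a)].
Proof.
move=> ag /exb_bool[p /exb_var[t /andP[Dt /orP[/exb_var[v /andP[Dv /orP[]]]|]]]].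
- move=> /andP[/eqP Es L]; exists p, (Eq t v); split.
  + by move=> w Ew; rewrite enc_lit_num -Ew.
  + by rewrite fr_atom_sub Dt.
  + exact: (literalP p x (sat_eqP t v)).1 L.
- move=> /exbP[R _ /andP[/eqP Es L]]; exists p, (Rel2 R t v);
    have Rs : R <= s by rewrite Es cons_nat3_ge.
  split.
  + by move=> w Ew; rewrite enc_lit_num -Ew.
  + by rewrite fr_atom_sub Dt.
  + apply: (literalP p x (fun s => sat_rel2P t v s (ag R Rs))).1 L.
- move=> /exbP[R _ /andP[/eqP Es L]]; exists p, (Rel1 R t);
    have Rs : R <= s by rewrite Es cons_nat3_ge.
  split.
  + by move=> w Ew; rewrite enc_lit_num -Ew.
  + by rewrite fr_atom_sub Dt.
  + apply: (literalP p x (fun s => sat_rel1P t s (ag R Rs))).1 L.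
Qed.

Lemma step_atom_complete u s w x dx dy (p : bool) a :
  (forall R, R <= s -> agree R) -> s <= u ->
  s = word_num (enc (signed_atom p a) ++ w) -> fr_atom a \subset Dset dx dy ->
  sat M (decode x) (signed_atom p a) -> step_atom n r1 r2 u s (word_num w) x dx dy.
Proof.
move=> ag su; rewrite enc_lit_num fr_atom_sub => Es D L.
apply/exb_bool; exists p; case: a Es D L => [t v|R t|R t v] Es D L; apply/exb_var; exists t.
- case/andP: D => -> Dv /=; apply/orP; left; apply/exb_var; exists v.
  rewrite Dv -Es eqxx /=; apply/orP; left.
  exact: (literalP p x (sat_eqP t v)).2 L.
- have Rs : R <= s by rewrite Es cons_nat3_ge.
  rewrite D /=; apply/orP; right; apply/exbP; exists R; first exact: leq_trans Rs su.
  by rewrite -Es eqxx; apply: (literalP p x (fun s => sat_rel1P t s (ag R Rs))).2 L.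
- have Rs : R <= s by rewrite Es cons_nat3_ge.
  case/andP: D => -> Dv /=; apply/orP; left; apply/exb_var; exists v.
  rewrite Dv /=; apply/orP; right; apply/exbP; exists R; first exact: leq_trans Rs su.
  by rewrite -Es eqxx; apply: (literalP p x (fun s => sat_rel2P t v s (ag R Rs))).2 L.
Qed.

(** Each premise concerns a strictly smaller suffix number, so recorded judgments can be verified by
    induction on [s] although a certificate is just a set. *)
Lemma step_sound u (J : judgment) s s' x dx dy : (forall R, agree R) ->
  (forall t t' y ex ey, t < s -> J t t' y ex ey -> derivable t t' y ex ey) ->
  step n r1 r2 u J s s' x dx dy -> derivable s s' x dx dy.
Proof.
move=> ag HJ /or4P[||/exbP[m _ /exbP[s1 _ /exbP[y _ /exbP[z _]]]]|/orP[]].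
- move=> /(step_atomP (fun R _ => ag R))[p [a [Es D satp]]].
  have [w Ew] := word_num_onto s'; exists (signed_atom p a), w; split=> //.
    by apply: Es.
  by rewrite fr_lit.
- move=> /exbP[m _ /exbP[s1 _ /and3P[/eqP Es Jf Jg]]].
  have [|f [w [E1 Em sf satf]]] := HJ _ _ _ _ _ _ Jf; first by rewrite Es cons_nat_gt.
  have [|g [v [Em' Es' sg satg]]] := HJ _ _ _ _ _ _ Jg.
    (* The first premise shows that [m] numbers a suffix of the word numbered [s1], hence
       [m <= s1 < s]. *)
    by rewrite Es (leq_ltn_trans _ (cons_nat_gt _ _)) // E1 Em word_num_cat.
  exists (And f g), v; split=> //; last by rewrite /= subUset sf.
  by rewrite enc_and_num Es E1; congr (cons_nat _ (word_num (_ ++ _)));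
    apply: word_num_inj; rewrite -Em.
- move=> /and4P[/eqP Es /union_team Ex Jf Jg].
  have [|f [w [E1 Em sf satf]]] := HJ _ _ _ _ _ _ Jf; first by rewrite Es cons_nat_gt.
  have [|g [v [Em' Es' sg satg]]] := HJ _ _ _ _ _ _ Jg.
    by rewrite Es (leq_ltn_trans _ (cons_nat_gt _ _)) // E1 Em word_num_cat.
  exists (Or f g), v; split=> //; last by exists (decode y), (decode z).
    by rewrite enc_or_num Es E1; congr (cons_nat _ (word_num (_ ++ _)));
      apply: word_num_inj; rewrite -Em.
  by rewrite /= subUset sf.
- move=> /exb_var[v /exbP[s1 _ /exbP[y _ /and3P[/eqP Es /duplicate_team Ey Jf]]]].
  have [|f [w [E1 Em sf satf]]] := HJ _ _ _ _ _ _ Jf.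
    by rewrite Es; exact: ltn_trans (cons_bit_gt _ _) (cons_nat_gt _ _).
  exists (Forall v f), w; split=> //; first by rewrite enc_forall_num -E1.
    by rewrite /= sub_setD1 -Dset_add.
  by rewrite /= -Ey.
- move=> /exb_var[v /exb_bool[wx /exb_bool[wy /exbP[s1 _ /exbP[y _ /exbP[G _]]]]]].
  move=> /and5P[/eqP Es Hx Hy HG /andP[Ey Jf]].
  have [|f [w [E1 Em sf satf]]] := HJ _ _ _ _ _ _ Jf.
    rewrite Es; apply: ltn_trans (cons_bit_gt wy _) _; apply: ltn_trans (cons_bit_gt wx _) _.
    exact: ltn_trans (cons_bit_gt (var_bit v) _) (cons_nat_gt _ _).
  have [F FG] := choice_graph_fun HG.
  set W : {set var} := [set t | 0 < sel_var (var_bit t) wx wy].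
  have HW t : (t \in W) = (0 < sel_var (var_bit t) wx wy) by rewrite inE.
  exists (Exists v W f), w; split=> //.
  + rewrite enc_exists_num -E1 Es !inE /sel_var /=.
    by case: (wx); case: (wy).
  + rewrite /= subUset sub_setD1 -Dset_add sf andbT.
    by apply/subsetP => -[]; rewrite !inE; apply/implyP.
  + exists F; split; first by apply/(choice_graphP HW FG).
    by rewrite -((supplement_team _ _ FG).1 Ey).
Qed.

(** The premises of a true judgment can be chosen in a fixed finite range of suffixes, teams and
    flags, so the true judgments in that range justify one another. The two powers of 2 bound the
    codes of teams and of choice graphs. *)
Lemma step_complete u (J : judgment) s s' x dx dy :
  (forall R, R <= s -> agree R) -> s <= u ->
  2 ^ (pair_num n n).+1 <= u -> 2 ^ (pair_num (pair_num n n) n).+1 <= u ->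
  (forall t t' y ex ey, t <= s -> y < 2 ^ (pair_num n n).+1 ->
     ex <= maxn 1 dx -> ey <= maxn 1 dy ->
     derivable t t' y ex ey -> J t t' y ex ey) ->
  x < 2 ^ (pair_num n n).+1 ->
  derivable s s' x dx dy -> step n r1 r2 u J s s' x dx dy.
Proof.
move=> ag su Nu Nu' HJ xN [f [w [Es -> sf satf]]].
have m1 d (b : bool) : (if b then 1 else d) <= maxn 1 d by case: b; lia.
have m2 d (b : bool) : (if b then d else 1) <= maxn 1 d by case: b; lia.
case: f Es sf satf => [a|a|f g|f g|v f|v W f] Es sf satf; apply/or4P.
- by apply/Or41/(step_atom_complete (p := false) ag su Es sf satf).
- by apply/Or41/(step_atom_complete (p := true) ag su Es sf satf).
- move: Es; rewrite enc_and_num => Es.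
  have fs : word_num (enc f ++ enc g ++ w) < s by rewrite Es cons_nat_gt.
  have gs := leq_ltn_trans (word_num_cat (enc f) _) fs.
  case: satf => satf satg; move: sf; rewrite /= subUset => /andP[sf sg].
  apply/Or42/exbP; exists (word_num (enc g ++ w)); first by lia.
  apply/exbP; exists (word_num (enc f ++ enc g ++ w)); first by lia.
  rewrite Es eqxx /= !HJ ?leq_maxr // ?(ltnW fs) ?(ltnW gs) //.
    by exists g, w.
  by exists f, (enc g ++ w).
- move: Es; rewrite enc_or_num => Es.
  have fs : word_num (enc f ++ enc g ++ w) < s by rewrite Es cons_nat_gt.
  have gs := leq_ltn_trans (word_num_cat (enc f) _) fs.
  case: satf => Y [Z [XYZ satf satg]]; move: sf; rewrite /= subUset => /andP[sf sg].
  have [y yN Ey] := encode_team Y; have [z zN Ez] := encode_team Z.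
  apply/Or43/exbP; exists (word_num (enc g ++ w)); first by lia.
  apply/exbP; exists (word_num (enc f ++ enc g ++ w)); first by lia.
  apply/exbP; exists y; first by lia.
  apply/exbP; exists z; first by lia.
  rewrite Es eqxx /= !HJ ?leq_maxr // ?(ltnW fs) ?(ltnW gs) ?andbT //.
  + by apply/union_team; rewrite Ey Ez.
  + by exists g, w; rewrite Ez.
  + by exists f, (enc g ++ w); rewrite Ey.
- move: Es; rewrite enc_forall_num => Es.
  have [y yN Ey] := encode_team (duplicate (decode x) v).
  have fs : word_num (enc f ++ w) <= s.
    by rewrite Es; exact: ltnW (ltn_trans (cons_bit_gt (var_bit v) _) (cons_nat_gt _ _)).
  apply/Or44/orP; left; apply/exb_var; exists v.
  apply/exbP; exists (word_num (enc f ++ w)); first by lia.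
  apply/exbP; exists y; first by lia.
  rewrite Es eqxx /= HJ ?andbT //; first exact/duplicate_team.
  by exists f, w; rewrite Ey; split=> //; rewrite Dset_add -sub_setD1.
- move: Es; rewrite enc_exists_num => Es.
  have [F [indF satF]] := satf.
  have [y yN Ey] := encode_team (supplement (decode x) F v).
  have [G GN FG] := encode_graph x F.
  have fs : word_num (enc f ++ w) <= s.
    rewrite Es ltnW //; apply: ltn_trans (cons_bit_gt (vy \in W) _) _.
    apply: ltn_trans (cons_bit_gt (vx \in W) _) _.
    exact: ltn_trans (cons_bit_gt (var_bit v) _) (cons_nat_gt _ _).
  move: sf; rewrite /= subUset => /andP[/subsetP sW sf].
  apply/Or44/orP; right; apply/exb_var; exists v.
  apply/exb_bool; exists (vx \in W); apply/exb_bool; exists (vy \in W).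
  apply/exbP; exists (word_num (enc f ++ w)); first by lia.
  apply/exbP; exists y; first by lia.
  apply/exbP; exists G; first by lia.
  rewrite Es eqxx /= HJ ?andbT //; last first.
    by exists f, w; rewrite Ey; split=> //; rewrite Dset_add -sub_setD1.
  apply/and4P; split.
  + by apply/implyP; rewrite lt0b => /sW; rewrite inE.
  + by apply/implyP; rewrite lt0b => /sW; rewrite inE.
  + apply/choice_graphP; [|exact: FG|exact: indF].
    by case; rewrite /sel_var /= lt0b.
  + exact/(supplement_team _ _ FG).
Qed.

End Meaning.

(** * Certificates and finite satisfiability *)

Lemma Dset0 : Dset 0 0 = set0.
Proof. by apply/setP => -[]; rewrite !inE. Qed.

Lemma nat_surj_ord n i : i < n -> exists a : 'I_n, a = i :> nat.
Proof. by move=> lt_in; exists (Ordinal lt_in). Qed.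

Lemma empty_teamP (A : finType) (rho : A -> nat) n (x : nat) :
  (forall a, rho a < n) -> (forall i, i < n -> exists a, rho a = i) ->
  alb n (fun a => alb n (fun b => bit x (pair_num a b) == (a == 0) && (b == 0))) <->
  decode rho x = (fun s => s = empty_assignment A).
Proof.
move=> rho_lt rho_onto; rewrite (alb_asg rho_lt rho_onto).
have H (s : assignment A) :
    (code rho (s vx) == 0) && (code rho (s vy) == 0) <-> s = empty_assignment A.
  split=> [|->]; last by rewrite !ffunE.
  case Ex: (s vx) => //; case Ey: (s vy) => //= _.
  by apply/ffunP => -[]; rewrite ffunE.
split=> [E|E s].
  by apply/funext => s; apply/propext; rewrite -H /decode (eqP (E s)).
have /= Hs : bit x (code_asg rho s) <-> s = empty_assignment A.
  by move: (congr1 (@^~ s) E) => /= <-.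
by apply/eqP; apply/idP/idP => [/Hs/H|/H/Hs].
Qed.

Lemma certificate_sound u w : certificate u (word_num w) -> FinSat_IF2 w.
Proof.
move=> /exbP[n _ /exbP[r1 _ /exbP[r2 _ /exbP[c cu /exbP[x0 _]]]]].
move=> /and4P[n0 /albP steps root start].
pose M : structure 'I_n := Structure (inhabits (Ordinal n0))
  (fun R a => bit r1 (pair_num R a.+1)) (fun R a b => bit r2 (pair_num R (pair_num a.+1
    b.+1))).
pose rho (a : 'I_n) : nat := a.
have rho_lt a : rho a < n by apply: ltn_ord.
have ag R : agree M rho r1 r2 R by [].
(* A recorded judgment is a digit position of [c], so its components lie below [c <= u], in the
   range where the certificate has been checked. *)
have bound s s' x dx dy : recorded c s s' x dx dy ->
    [/\ s <= u, s' <= u, x <= u, dx <= u & dy <= u].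
  move/bit_lt; have [? ?] := pair_num_le s (pair_num s' (pair_num x (pair_num dx dy))).
  have [? ?] := pair_num_le s' (pair_num x (pair_num dx dy));
    have [? ?] := pair_num_le x (pair_num dx dy).
  by have [? ?] := pair_num_le dx dy; split; lia.
have sound s : forall s' x dx dy, recorded c s s' x dx dy ->
    derivable M rho s s' x dx dy.
  elim/ltn_ind: s => s IH s' x dx dy rec_s.
  have [su su' xu dxu dyu] := bound _ _ _ _ _ rec_s.
  have /albP/(_ s' su')/albP/(_ x xu)/albP/(_ dx dxu)/albP/(_ dy dyu) := steps s su.
  rewrite rec_s /=; apply: step_sound => //; first exact: val_inj.
    exact: nat_surj_ord.
  by move=> t t' y ex ey ts; apply: IH.
have [f [v [Ew Ev sf satf]]] := sound _ _ _ _ _ root.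
(* The rest after the formula has number 0, hence is empty: the formula fills the whole input. *)
have v0 : v = [::] by apply: word_num_inj; rewrite -Ev.
move: Ew; rewrite v0 cats0 => /word_num_inj ->; exists f; split=> //.
  by apply/eqP; rewrite -subset0 -Dset0.
exists 'I_n, M; rewrite /truth.
by rewrite -((empty_teamP x0 rho_lt (@nat_surj_ord n)).1 start).
Qed.

Lemma certificate_complete w : FinSat_IF2 w -> exists u, certificate (word_num u) (word_num w).
Proof.
move=> [f [-> sf [A [M satf]]]]; pose n := #|A|; pose rho (a : A) : nat := enum_rank a.
have rho_inj : injective rho by move=> a b /val_inj/enum_rank_inj.
have rho_lt a : rho a < n by apply: ltn_ord.
have rho_onto i : i < n -> exists a, rho a = i.
  by move=> lt_in; exists (enum_val (Ordinal lt_in)); rewrite /rho enum_valK.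
pose S := word_num (enc f).
(* Only the symbols up to [S] are recorded, which includes all those of [f]. *)
have [r1 _ Hr1] := bitmask (pair_num S n).+1
  (fun j => exists R a, j = pair_num R (rho a).+1 /\ rel1 M R a).
have [r2 _ Hr2] := bitmask (pair_num S (pair_num n n)).+1
  (fun j => exists R a b, j = pair_num R (pair_num (rho a).+1 (rho b).+1) /\ rel2 M R a b).
have ag R : R <= S -> agree M rho r1 r2 R.
  move=> RS; split=> [a|a b].
    split=> [Ra|/Hr1[_ [R' [a' [/pair_num_inj[<- [/rho_inj <-]]]]]] //].
    by apply/Hr1; split; [rewrite ltnS; apply: pair_num_mono (rho_lt a) | exists R, a].
  split=> [Rab|/Hr2[_ [R' [a' [b' [/pair_num_inj[<- /pair_num_inj[[/rho_inj <-] [/rho_inj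
    <-]]]]]]]] //].
  apply/Hr2; split; last by exists R, a, b.
  by rewrite ltnS; apply: pair_num_mono => //; apply: pair_num_mono (rho_lt a) (rho_lt b).
pose X := 2 ^ (pair_num n n).+1.
have [c _ Hc] := bitmask (pair_num S (pair_num S (pair_num X (pair_num 1 1)))).+1
  (fun j => exists s s' x dx dy, [/\ j = pair_num s (pair_num s' (pair_num x (pair_num dx
    dy))),
     [/\ s <= S, x < X, dx <= 1 & dy <= 1] & derivable M rho s s' x dx dy]).
have recP s s' x dx dy : s <= S -> x < X -> dx <= 1 -> dy <= 1 ->
    derivable M rho s s' x dx dy -> recorded c s s' x dx dy.
  move=> sS xX dx1 dy1 der; apply/Hc; split; last by exists s, s', x, dx, dy.
  have s's : s' <= s by case: der => g [v [-> -> _ _]]; apply: word_num_cat.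
  rewrite ltnS; apply: pair_num_mono => //; apply: pair_num_mono; first exact: leq_trans sS.
  by apply: pair_num_mono; [exact: ltnW | exact: pair_num_mono].
have [x0 x0X Ex0] := encode_team rho_inj rho_lt (fun s => s = empty_assignment A).
(* A sum of everything that must stay below the bound; the word of [u] letters [true] has a number
   at least [u]. *)
pose u := n + r1 + r2 + c + S + X + 2 ^ (pair_num (pair_num n n) n).+1.
have uP : u <= word_num (nseq u true) by elim: (u) => //= k; lia.
exists (nseq u true); set U := word_num _ in uP *.
have [nU r1U r2U cU] : [/\ n <= U, r1 <= U, r2 <= U & c <= U] by split; lia.
have SU : S <= U by lia.
have XU : X <= U by lia.
have GU : 2 ^ (pair_num (pair_num n n) n).+1 <= U by lia.
apply/exbP; exists n => //; apply/exbP; exists r1 => //; apply/exbP; exists r2 => //.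
apply/exbP; exists c => //; apply/exbP; exists x0; first by lia.
apply/and4P; split.
- by have [a] := nonempty M; apply/card_gt0P; exists a.
- apply/albP => s _; apply/albP => s' _; apply/albP => x _; apply/albP => dx _.
  apply/albP => dy _; apply/implyP => /Hc[_ [t [t' [y [ex [ey [E [tS yX ex1 ey1] der]]]]]]].
  case/pair_num_inj: E => -> /pair_num_inj[-> /pair_num_inj[-> /pair_num_inj[-> ->]]].
  apply: (step_complete rho_inj rho_lt rho_onto _ (leq_trans tS SU) XU GU _ yX der).
    by move=> R /leq_trans/(_ tS)/ag.
  move=> q q' z dx' dy' qt zX dx1 dy1; apply: recP => //; [exact: leq_trans tS|lia|lia].
- apply: recP => //; exists f, [::]; split=> //; first by rewrite cats0.
    by rewrite Dset0 sf.
  by rewrite Ex0.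
- exact/(empty_teamP x0 rho_lt rho_onto).
Qed.

Lemma Sigma01_FinSat : Sigma01 FinSat_IF2.
Proof.
exists (fun w u => certificate (word_num u) (word_num w)); split; last first.
  move=> w; split; first exact: certificate_complete.
  by case=> u; apply: certificate_sound.
have [e He] := recursive_subst recursiveb_certificate
  (recursive_list_cons (recursive_nth 1 recursive_list_id) (recursive_list_cons
    (recursive_nth 0 recursive_list_id) recursive_list_nil)) 2.
by exists e => w u; apply: He.
Qed.

(** * From recursive functions to combinators *)

Inductive tree := Leaf | Node (t u : tree).

(** Point-free: every program maps one tree to one tree and a step has at most two premises, so a
    run is described by binary relations for argument, result, first and second premise. *)
Inductive comb :=
| Id | ConstLeaf | Car | Cdr
| Pair (c d : comb)
| Seq (c d : comb)
| While (c : comb).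

(** The first component of the state is the test, with [Leaf], the numeral zero, as exit. Counting
    down and searching for a zero thus take the same form. *)
Inductive loop (R : tree -> tree -> Prop) : tree -> tree -> Prop :=
| loop_stop y : loop R (Node Leaf y) y
| loop_go a b z s y : R (Node (Node a b) z) s -> loop R s y ->
    loop R (Node (Node a b) z) y.

Fixpoint runs c : tree -> tree -> Prop :=
  match c with
  | Id => fun t y => y = t
  | ConstLeaf => fun _ y => y = Leaf
  | Car => fun t y => exists u, t = Node y u
  | Cdr => fun t y => exists u, t = Node u y
  | Pair c d => fun t y => exists a b, [/\ runs c t a, runs d t b & y = Node a b]
  | Seq c d => fun t y => exists2 a, runs c t a & runs d a y
  | While c => loop (runs c)
  end.

Definition num_tree n := iter n (Node Leaf) Leaf.
Definition tup (v : seq nat) := foldr (fun n t => Node (num_tree n) t) Leaf v.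

Definition succ_comb := Pair ConstLeaf Car.
Fixpoint cdrs i := if i is j.+1 then Seq Cdr (cdrs j) else Id.

(** The state holds a countdown, the index reached, the value there and the parameters. The
    countdown is the loop test; the remainder of the state is exactly the argument tuple that [g]
    expects. *)
Definition prec_init f := Pair Car (Pair ConstLeaf (Pair (Seq Cdr f) Cdr)).
Definition prec_body g :=
  Pair (Seq Car Cdr)
    (Pair (Pair ConstLeaf (Seq Cdr Car)) (Pair (Seq Cdr g) (Seq Cdr (Seq Cdr Cdr)))).

Fixpoint compile n (e : recf n) : comb :=
  match e with
  | Zero _ => ConstLeaf
  | Succ => succ_comb
  | Proj _ i => Seq (cdrs i) Car
  | Comp k _ f g => Seq (foldr (fun i c => Pair (compile (g i)) c) ConstLeaf (enum 'I_k))
    (compile f)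
  | Prec _ f g => Seq (prec_init (compile f)) (Seq (While (prec_body (compile g))) (Seq Cdr
    Car))
  | Mu _ f => Seq (Seq (Pair ConstLeaf Id) (Pair (compile f) Id))
      (Seq (While (Seq Cdr (Seq (Pair succ_comb Cdr) (Pair (compile f) Id)))) Car)
  end.

Lemma runs_cdrs i v t : runs (cdrs i) (tup v) t -> t = tup (drop i v).
Proof.
elim: i v => [|i IH] v /=; first by rewrite drop0.
by case: v => [|a v] [u [w //]] [_ <-] /IH.
Qed.

Lemma cdrs_runs i v : i <= size v -> runs (cdrs i) (tup v) (tup (drop i v)).
Proof.
elim: i v => [|i IH] [|a v] //= iv.
by exists (tup v); [exists (num_tree a) | apply: IH].
Qed.

(** An equivalence, so that an output of the program also implies that the function is defined: the
    reduction needs both directions. *)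
Definition computes n (e : recf n) c := forall (v : n.-tuple nat) t,
  runs c (tup v) t <-> exists2 m, t = num_tree m & eval e v m.

Lemma computes_proj n (i : 'I_n) : computes (Proj i) (Seq (cdrs i) Car).
Proof.
move=> v t; have iv : i < size v by rewrite size_tuple.
rewrite /= (tnth_nth 0); split.
  case=> a /runs_cdrs ->; rewrite (drop_nth 0 iv) => -[u [<- _]].
  by exists (nth 0 v i).
case=> _ -> ->; exists (tup (drop i v)); first exact/cdrs_runs/ltnW.
by rewrite (drop_nth 0 iv); exists (tup (drop i.+1 v)).
Qed.

Lemma computes_comp k n (f : recf k) (g : 'I_k -> recf n) cf cg :
  computes f cf -> (forall i, computes (g i) (cg i)) ->
  computes (Comp f g) (Seq (foldr (fun i c => Pair (cg i) c) ConstLeaf (enum 'I_k)) cf).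
Proof.
move=> Hf Hg v t.
(* The intermediate values are a function [h] on indices; since the indices are distinct, its value
   at [i] can be set without disturbing the others. *)
have args (s : seq 'I_k) a : uniq s ->
    runs (foldr (fun i c => Pair (cg i) c) ConstLeaf s) (tup v) a <->
    exists h, (forall i, i \in s -> eval (g i) v (h i)) /\ a = tup (map h s).
  elim: s a => [|i s IH] a /=; first by split=> [->|[h [_ ->]]] //; exists (fun=> 0).
  case/andP=> is_ us; split.
    case=> x [y [/Hg[m -> em] /(IH _ us)[h [eh ->]] ->]].
    exists (fun j => if j == i then m else h j); split.
      by move=> j; rewrite inE; case: eqP => [->|_ /eh].
    rewrite eqxx /=; congr (Node _ (tup _)); apply/eq_in_map => j js.
    by case: eqP => // ji; rewrite -ji js in is_.
  case=> h [eh ->]; exists (num_tree (h i)), (tup (map h s)); split=> //.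
    by apply/Hg; exists (h i) => //; apply: eh; rewrite mem_head.
  by apply/IH => //; exists h; split=> // j js; apply: eh; rewrite inE js orbT.
split.
  case=> a /args[|h [eh ->]]; first exact: enum_uniq.
  rewrite -[map h _]/(tval [tuple of map h (ord_tuple k)]) => /Hf[m -> em].
  exists m => //; exists [tuple of map h (ord_tuple k)]; split=> // i.
  by rewrite tnth_map tnth_ord_tuple; apply: eh; rewrite mem_enum.
case=> m -> [w [ew em]]; exists (tup w); last by apply/Hf; exists m.
apply/args; first exact: enum_uniq.
exists (tnth w); split=> // [i _|]; first exact: ew.
by congr tup; rewrite map_tnth_enum.
Qed.

(** The anonymous fixpoint inside [eval], named so that inductions can refer to it. *)
Definition prec_iter n (f : recf n) (g : recf n.+2) (u : n.-tuple nat) :=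
  fix iterate k m : Prop :=
    match k with
    | 0 => eval f u m
    | k'.+1 => exists r, iterate k' r /\ eval g [tuple of k' :: r :: u] m
    end.

Lemma eval_prec n (f : recf n) (g : recf n.+2) k (u : n.-tuple nat) m :
  eval (Prec f g) [tuple of k :: u] m = prec_iter f g u k m.
Proof.
rewrite -[LHS]/(prec_iter f g [tuple of behead [tuple of k :: u]]
  (thead [tuple of k :: u]) m) theadE.
by congr (prec_iter f g _ k m); apply: val_inj.
Qed.

Lemma computes_prec n (f : recf n) (g : recf n.+2) cf cg :
  computes f cf -> computes g cg ->
  computes (Prec f g)
    (Seq (prec_init cf) (Seq (While (prec_body cg)) (Seq Cdr Car))).
Proof.
move=> Hf Hg v t; case/tupleP: v => k u.
have -> : (exists2 m, t = num_tree m & eval (Prec f g) [tuple of k :: u] m) =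
    (exists2 m, t = num_tree m & prec_iter f g u k m).
  by congr ex2; apply/funext => m; rewrite eval_prec.
set it := prec_iter f g u; rewrite /=.
pose st j i r := Node (num_tree j) (Node (num_tree i) (Node (num_tree r) (tup u))).
have init s : runs (prec_init cf) (Node (num_tree k) (tup u)) s <->
    exists2 r, it 0 r & s = st k 0 r.
  split; rewrite /prec_init /=.
    case=> a [b [[w [<- _]] [a2 [b2 [-> [a3 [b3 [[z [w2 [_ <-]] Hz] [w3 [_ <-]] ->]]] ->]]]
      ->]].
    by move/Hf: Hz => [r -> er]; exists r.
  case=> r er ->; exists (num_tree k), (Node Leaf (Node (num_tree r) (tup u))).
  split=> //; first by exists (tup u).
  exists Leaf, (Node (num_tree r) (tup u)); split=> //; exists (num_tree r), (tup u).
  split=> //; last by exists (num_tree k).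
  by exists (tup u); [exists (num_tree k) | apply/Hf; exists r].
have body j i r s : runs (prec_body cg) (st j.+1 i r) s <->
    exists2 r', eval g [tuple of i :: r :: u] r' & s = st j i.+1 r'.
  split; rewrite /prec_body /=.
    case=> a [b [[z [w [<- _]] [w1 [_ <-]]] [a2 [b2 [H ]]]]].
    case: H => [a3 [b3 [-> [z1 [w2 [_ <-]] [w3 [<- _]]] ->]]].
    case=> a4 [b4 [[z2 [w4 [_ <-]] Hz] [z3 [w5 [_ <-]] [z4 [w6 [_ <-]] [w7 [_ <-]]]] ->]].
    move=> -> ->; have [r' -> er] := (Hg [tuple of i :: r :: u] _).1 Hz.
    by exists r'.
  case=> r' er ->; eexists; eexists; split=> //.
    by exists (num_tree j.+1); [eexists | exists Leaf].
  eexists; eexists; split=> //.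
    eexists; eexists; split=> //.
    by eexists; [eexists | eexists].
  eexists; eexists; split=> //.
    eexists; first by eexists.
    by apply: (Hg [tuple of i :: r :: u] _).2; exists r'.
  by eexists; [eexists | eexists; [eexists | eexists]].
have stop i r y : loop (runs (prec_body cg)) (st 0 i r) y <->
    y = Node (num_tree i) (Node (num_tree r) (tup u)).
  by split=> [H|->]; [inversion H | apply: loop_stop].
have go j i r y : loop (runs (prec_body cg)) (st j.+1 i r) y <->
    exists2 r', eval g [tuple of i :: r :: u] r' &
      loop (runs (prec_body cg)) (st j i.+1 r') y.
  split=> [H|[r' er H]]; last by apply: loop_go H; apply/body; exists r'.
  inversion H as [|a b z s y' Hs Hl E1 E2]; subst.
  by move/body: Hs => [r' er Es]; exists r'; rewrite -?Es.
(* From index [i] with [j] rounds left, the loop must exit at index [i + j]. *)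
have fwd j : forall i r y, it i r -> loop (runs (prec_body cg)) (st j i r) y ->
    exists2 r', it (i + j) r' & y = Node (num_tree (i + j)) (Node (num_tree r') (tup u)).
  elim: j => [|j IH] i r y ir; first by move/stop->; exists r; rewrite addn0.
  by move/go=> [r' er /IH]; rewrite addSnnS; apply; exists r.
(* Conversely, a loop that continues from index [i] extends backwards to one that starts at index
   0. *)
have bwd i : forall j r y, it i r -> loop (runs (prec_body cg)) (st j i r) y ->
    exists2 r0, it 0 r0 & loop (runs (prec_body cg)) (st (i + j) 0 r0) y.
  elim: i => [|i IH] j r y; first by exists r.
  by case=> r' [ir' er'] H; rewrite addSnnS; apply: (IH _ r' _ ir'); apply/go; exists r.
split.
  case=> s /init[r ir ->] [y /(fwd _ _ _ _ ir)[r' ir' ->]].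
  by case=> z [w [_ <-]] [w' [<- _]]; exists r'.
case=> m -> im; have := bwd k 0 m (Node (num_tree k) (Node (num_tree m) (tup u))) im.
case; first exact/stop.
rewrite addn0 => r0 ir0 L; exists (st k 0 r0); first by apply/init; exists r0.
exists (Node (num_tree k) (Node (num_tree m) (tup u))) => //.
by exists (Node (num_tree m) (tup u)); eexists.
Qed.

(** The state is the value of [f] at the current candidate, followed by the candidate and the
    parameters: the loop exits precisely when that value is zero. *)
Lemma computes_mu n (f : recf n.+1) cf : computes f cf ->
  computes (Mu f) (Seq (Seq (Pair ConstLeaf Id) (Pair cf Id))
      (Seq (While (Seq Cdr (Seq (Pair succ_comb Cdr) (Pair cf Id)))) Car)).
Proof.
move=> Hf v t; set body := Seq Cdr _.
have eval_f m s : runs (Pair cf Id) (tup (m :: v)) s <->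
    exists2 r, eval f [tuple of m :: v] r & s = Node (num_tree r) (tup (m :: v)).
  split=> [[a [b [/(Hf [tuple of m :: v])[r -> er] -> ->]]]|[r er ->]].
    by exists r.
  exists (num_tree r), (tup (m :: v)); split=> //.
  by apply/(Hf [tuple of m :: v]); exists r.
have step m r s : runs body (Node (num_tree r) (tup (m :: v))) s <->
    exists2 r', eval f [tuple of m.+1 :: v] r' & s = Node (num_tree r') (tup (m.+1 :: v)).
  split.
    case=> z [w [_ <-]] [z' [a [b [Ha [w' [_ <-]] ->]]]].
    case: Ha => [a1 [b1 [-> [w1 [<- _]] ->]]]; exact: (eval_f m.+1 s).1.
  move=> H; exists (tup (m :: v)); first by eexists.
  exists (tup (m.+1 :: v)); last exact/eval_f.
  exists (num_tree m.+1), (tup v); split=> //; last by eexists.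
  by exists Leaf, (num_tree m); split=> //; eexists.
have fwd s y : loop (runs body) s y -> forall m r, s = Node (num_tree r) (tup (m :: v)) ->
    eval f [tuple of m :: v] r ->
    (forall k, k < m -> exists r, eval f [tuple of k :: v] r.+1) ->
    exists2 m', y = tup (m' :: v) & eval (Mu f) v m'.
  elim=> [{}y|a b z s' {}y Hs _ IH] m [|r] //.
    by case=> -> ? ?; exists m.
  move=> E er below; rewrite E in Hs; move/step: Hs => [r' er' Es'].
  apply: IH Es' er' _ => k; rewrite ltnS leq_eqVlt => /orP[/eqP->|/below//].
  by exists r.
split.
  case=> s [z [a [b [-> -> ->]]]] /(eval_f 0)[r er ->] [y].
  by move/fwd => /(_ 0 r erefl er)[//|m -> em] [w [<- _]]; exists m.
case=> m -> [em below].
(* The loop is built from its end: [j] is the distance of the candidate from the least zero [m]. *)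
have bwd j : j <= m -> exists2 r, eval f [tuple of m - j :: v] r &
    loop (runs body) (Node (num_tree r) (tup (m - j :: v))) (tup (m :: v)).
  elim: j => [|j IH] jm; first by exists 0; rewrite subn0 //; apply: loop_stop.
  have [|r er L] := IH; first exact: ltnW.
  have [|r' er'] := below (m - j.+1); first by lia.
  exists r'.+1 => //; apply: loop_go L; apply/(step _ r'.+1).
  by exists r; rewrite -subnSK // in er *.
have [r] := bwd m (leqnn m); rewrite subnn => er L.
exists (Node (num_tree r) (tup (0 :: v))); last by exists (tup (m :: v)) => //; eexists.
exists (tup (0 :: v)); last by apply/eval_f; exists r.
by exists Leaf, (tup v).
Qed.

Lemma compileP n (e : recf n) : computes e (compile e).
Proof.
elim: e => [{}n||{}n i|k {}n f IHf g IHg|{}n f IHf g IHg|{}n f IHf].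
- by move=> v t; split=> [->|[m -> ->]] //; exists 0.
- move=> v t; rewrite (tuple_eta v) /= theadE; split.
    by case=> a [b [-> [w [<- _]] ->]]; exists (thead v).+1.
  by case=> m -> ->; exists Leaf, (num_tree (thead v)); split=> //; eexists.
- exact: computes_proj.
- exact: computes_comp.
- exact: computes_prec.
- exact: computes_mu.
Qed.

(** * Flatness and the independence pattern *)

Fixpoint first_order f : bool :=
  match f with
  | Pos _ | Neg _ => true
  | And f g | Or f g => first_order f && first_order g
  | Forall _ f => first_order f
  | Exists _ W f => (W == set0) && first_order f
  end.

Section Flatness.

Variables (A : Type) (M : structure A).

Definition asg (a b : A) : assignment A := [ffun v => Some (if v is vx then a else b)].

Definition pair_team (X : A -> A -> Prop) : team A :=
  fun s => exists a b, X a b /\ s = asg a b.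

Definition vl (a b : A) v := if v is vx then a else b.

Fixpoint holds (a b : A) f : Prop :=
  match f with
  | Pos (Eq t u) => vl a b t = vl a b u
  | Pos (Rel1 R t) => rel1 M R (vl a b t)
  | Pos (Rel2 R t u) => rel2 M R (vl a b t) (vl a b u)
  | Neg (Eq t u) => vl a b t <> vl a b u
  | Neg (Rel1 R t) => ~ rel1 M R (vl a b t)
  | Neg (Rel2 R t u) => ~ rel2 M R (vl a b t) (vl a b u)
  | And f g => holds a b f /\ holds a b g
  | Or f g => holds a b f \/ holds a b g
  | Forall vx f => forall c, holds c b f
  | Forall vy f => forall c, holds a c f
  | Exists vx _ f => exists c, holds c b f
  | Exists vy _ f => exists c, holds a c f
  end.

Lemma asg_inj a b a' b' : asg a b = asg a' b' -> a = a' /\ b = b'.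
Proof. by move=> /ffunP E; have := E vx; have := E vy; rewrite !ffunE => -[->] [->]. Qed.

Lemma update_asg a b v c : update (asg a b) v c = if v is vx then asg c b else asg a c.
Proof. by apply/ffunP => u; case: v; case: u; rewrite !ffunE. Qed.

Lemma pair_team_sub (X : A -> A -> Prop) (Y : team A) :
  (forall s, Y s -> pair_team X s) -> Y = pair_team (fun a b => Y (asg a b)).
Proof.
move=> YX; apply/funext => s; apply/propext; split; last by case=> a [b [Y' ->]].
by move=> Ys; have [a [b [_ E]]] := YX s Ys; exists a, b; rewrite -E.
Qed.

Lemma dom_asg a b : dom (asg a b) = setT.
Proof. by apply/setP => v; rewrite !inE ffunE. Qed.

Lemma duplicate_pair_team X v : duplicate (pair_team X) v =
  pair_team (fun a b => exists c, if v is vx then X c b else X a c).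
Proof.
apply/funext => s; apply/propext; split.
  case=> _ [c [[a [b [Xab ->]]] ->]]; rewrite update_asg.
  by case: v; [exists c, b; split=> //; exists a | exists a, c; split=> //; exists b].
case=> a [b [[c]]]; case: v => Xab ->.
  by exists (asg c b), a; split; [exists c, b | rewrite update_asg].
by exists (asg a c), b; split; [exists a, c | rewrite update_asg].
Qed.

Lemma supplement_pair_team X F v : supplement (pair_team X) F v =
  pair_team (fun a b => exists c, if v is vx then X c b /\ a = F (asg c b)
                             else X a c /\ b = F (asg a c)).
Proof.
apply/funext => s; apply/propext; split.
  case=> _ [[a [b [Xab ->]]] ->]; rewrite update_asg.
  by case: v; do 2!eexists; (split; last reflexivity); [exists a | exists b].
case=> a [b [[c]]]; case: v => -[Xab ->] ->.
  by exists (asg c b); split; [exists c, b | rewrite update_asg].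
by exists (asg a c); split; [exists a, c | rewrite update_asg].
Qed.

(** Flatness. For a disjunction the team is split according to which disjunct holds; for an
    existential quantifier with empty slash set the witness may be chosen separately for each
    assignment. *)
Lemma flat f X : first_order f ->
  sat M (pair_team X) f <-> forall a b, X a b -> holds a b f.
Proof.
elim: f X => [a|a|f IHf g IHg|f IHf g IHg|v f IH|v W f IH] X /=.
- move=> _; split=> H.
    move=> b c Xbc; have /= := H _ (ex_intro _ b (ex_intro _ c (conj Xbc erefl))).
    by case: a {H} => [t u|R t|R t u]; rewrite /= !ffunE.
  move=> _ [b [c [/H + ->]]].
  by case: a {H} => [t u|R t|R t u]; rewrite /= !ffunE.
- move=> _; split=> H.
    move=> b c Xbc; have /= := H _ (ex_intro _ b (ex_intro _ c (conj Xbc erefl))).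
    by case: a {H} => [t u|R t|R t u]; rewrite /= !ffunE.
  move=> _ [b [c [/H + ->]]].
  by case: a {H} => [t u|R t|R t u]; rewrite /= !ffunE.
- case/andP=> /IHf Hf /IHg Hg; rewrite Hf Hg; split=> [[H1 H2] a b Xab|H].
    by split; [apply: H1 | apply: H2].
  by split=> a b /H[].
- case/andP=> /IHf Hf /IHg Hg; split.
    case=> Y [Z [E]].
    have -> : Y = pair_team (fun a b => Y (asg a b)) by apply: (@pair_team_sub X) => s ?;
      apply/E; left.
    have -> : Z = pair_team (fun a b => Z (asg a b)) by apply: (@pair_team_sub X) => s ?;
      apply/E; right.
    move=> /Hf HY /Hg HZ a b Xab.
    have /E[] : pair_team X (asg a b) by exists a, b.
      by move/HY; left.
    by move/HZ; right.
  move=> H; exists (pair_team (fun a b => X a b /\ holds a b f)), (pair_team (fun a b => X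
    a b /\ holds a b g)).
  split; [|by apply/Hf => a b []|by apply/Hg => a b []].
  move=> s; split.
    by case=> a [b [Xab ->]]; case: (H a b Xab) => ?; [left|right]; exists a, b.
  by case=> -[a [b [[Xab _] ->]]]; exists a, b.
- move=> /IH Hf; rewrite duplicate_pair_team Hf; case: v; split=> H a b.
  + by move=> Xab c; apply: H; exists a.
  + by case=> c /H.
  + by move=> Xab c; apply: H; exists b.
  + by case=> c /H.
- case/andP=> /eqP -> /IH Hf; split.
    case=> F [_]; rewrite supplement_pair_team Hf => H a b Xab.
    by case: v H => H; exists (F (asg a b)); apply: H; [exists a | exists b].
  move=> H; have ex (s : assignment A) : exists c, forall a b, X a b -> s = asg a b ->
      if v is vx then holds c b f else holds a c f.
    have [[a [b [Xab ->]]]|nX] := pselect (pair_team X s).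
      by case: v H => /(_ a b Xab)[c Hc]; exists c => a' b' _ /asg_inj[? ?]; subst.
    have [c] := nonempty M; exists c => a b Xab Es.
    by case: nX; exists a, b.
  have [F HF] := choice ex; exists F; split.
    move=> _ _ [a [b [_ ->]]] [a' [b' [_ ->]]] E; congr F.
    by apply/ffunP => u; apply: E; rewrite setD0 dom_asg.
  rewrite supplement_pair_team Hf => a b.
  by case: v H ex HF => H ex HF [c [Xc ->]]; have := HF _ _ _ Xc erefl.
Qed.

(** Truth after the prefix [forall x forall y]. It distributes over [And] by definition, so the
    axioms can be treated one at a time. *)
Definition full f := sat M (pair_team (fun _ _ => True)) f.

Lemma full_fo f : first_order f -> full f <-> forall a b, holds a b f.
Proof. by move=> /flat H; rewrite /full H; split=> K a b; [apply: K | move=> _; apply: K]. Qed.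

(** The choice of the new [vx] may depend on its old value [a] but not on [vy], so the witness taken
    at one [b0] serves every [b] that is not absorbed by the first disjunct. *)
Lemma full_henkin f g : first_order f -> first_order g ->
  full (Or f (Exists vx [set vy] g)) <->
  forall a, exists c, forall b, holds a b f \/ holds c b g.
Proof.
move=> fo_f fo_g; rewrite /full /=; split.
  case=> Y [Z [E]].
  have -> : Y = pair_team (fun a b => Y (asg a b)).
    by apply: (@pair_team_sub (fun _ _ => True)) => s ?; apply/E; left.
  have -> : Z = pair_team (fun a b => Z (asg a b)).
    by apply: (@pair_team_sub (fun _ _ => True)) => s ?; apply/E; right.
  move/(flat _ fo_f) => HY [F [indF]]; rewrite supplement_pair_team => /(flat _ fo_g) HZ a.
  have YZ b : Y (asg a b) \/ Z (asg a b) by apply/E; exists a, b.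
  (* If no pair with first component [a] goes to [Z], then [f] holds at all of them and any witness
     will do. *)
  have [[b0 Z0]|nZ] := pselect (exists b, Z (asg a b)); last first.
    exists a => b; left; apply: HY; case: (YZ b) => // Zab.
    by case: nZ; exists b.
  exists (F (asg a b0)) => b; case: (YZ b) => [/HY|Zab]; first by left.
  right; apply: HZ; exists a; split=> //; apply: indF; [by exists a, b0|by exists a, b|].
  by move=> [|]; rewrite !inE ?andbF // !ffunE.
move=> /choice[F HF]; have [c0] := nonempty M.
exists (pair_team (fun a b => holds a b f)), (pair_team (fun a b => holds (F a) b g)).
split.
- move=> s; split.
    by case=> a [b [_ ->]]; case: (HF a b); [left|right]; exists a, b.
  by case=> -[a [b [_ ->]]]; exists a, b.
- by apply/flat.
- exists (fun s => if s vx is Some a then F a else F c0).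
  split.
    move=> _ _ [a [b [_ ->]]] [a' [b' [_ ->]]] /(_ vx).
    by rewrite !inE !ffunE => /(_ isT)[->].
  by rewrite supplement_pair_team; apply/flat => // a b [c [H]]; rewrite !ffunE => ->.
Qed.

Lemma truth_full f : truth M (Forall vx (Forall vy f)) <-> full f.
Proof.
rewrite /truth /full /=; suff -> : duplicate (duplicate (eq^~ (empty_assignment A)) vx) vy =
  pair_team (fun _ _ => True) by [].
apply/funext => s; apply/propext; split.
  case=> _ [b [[_ [a [-> ->]]] ->]]; exists a, b; split=> //.
  by apply/ffunP => -[]; rewrite !ffunE.
case=> a [b [_ ->]]; exists (update (empty_assignment A) vx a), b; split.
  by exists (empty_assignment A), a.
by apply/ffunP => -[]; rewrite !ffunE.
Qed.

End Flatness.

(** * Axioms of computations *)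

Fixpoint comb_code c :=
  match c with
  | Id => 0 | ConstLeaf => 1 | Car => 2 | Cdr => 3
  | Pair c d => 4 + 3 * pair_num (comb_code c) (comb_code d)
  | Seq c d => 5 + 3 * pair_num (comb_code c) (comb_code d)
  | While c => 6 + 3 * comb_code c
  end.

Lemma comb_code_inj : injective comb_code.
Proof.
elim=> [||||c IHc d IHd|c IHc d IHd|c IHc] [||||c' d'|c' d'|c'] //=; try lia.
- move=> E; suff /pair_num_inj[/IHc -> /IHd -> //] :
    pair_num (comb_code c) (comb_code d) = pair_num (comb_code c') (comb_code d') by [].
  by lia.
- move=> E; suff /pair_num_inj[/IHc -> /IHd -> //] :
    pair_num (comb_code c) (comb_code d) = pair_num (comb_code c') (comb_code d') by [].
  by lia.
- by move=> E; congr While; apply: IHc; lia.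
Qed.

(* An element of a model is either a tree or a step of a run.  [is_snd] marks the
   second premise of a step, which lets [commute] tell it from the first one; a
   step is [fresh] unless it is a further iteration of a loop. *)
Definition is_leaf := 0.
Definition is_tree := 1.
Definition is_snd := 2.
Definition fresh := 3.
(** [Call] marks the steps of a program. [Stop] and [Go], indexed by the body of a loop, mark the
    steps of the loop whose test is a leaf or a node. *)
Inductive role := Call | Stop | Go.
Definition role_num r := match r with Call => 0 | Stop => 1 | Go => 2 end.
(** The offset 4 keeps clear of the four predicates above. *)
Definition kind (r : role) c := 4 + (3 * comb_code c + role_num r).

Lemma kind_inj r c r' c' : kind r c = kind r' c' -> r = r' /\ c = c'.
Proof.
move=> E; have Er : role_num r = role_num r' by rewrite /kind in E;
  case: r r' E => [] [] /=; lia.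
have Ec : comb_code c = comb_code c' by rewrite /kind in E; lia.
by split; [case: r r' Er {E} => [] [] | apply: comb_code_inj].
Qed.

Definition car := 0.
Definition cdr := 1.
Definition arg := 2.
Definition res := 3.
Definition fst_ := 4.
Definition snd_ := 5.
(** Leads from a further iteration of a loop back to the one before it. Functionality of this
    converse is injectivity of the successor map. *)
Definition prev_step := 6.

Notation eq_yx := (Eq vy vx).
Notation rel_yx R := (Rel2 R vy vx).
Notation rel_xy R := (Rel2 R vx vy).
Notation ex_x f := (Exists vx set0 f).
Notation ex_y f := (Exists vy set0 f).

(** The pattern with witness [c]: all [R]-successors of [a] are equal to [c]. *)
Definition functional R := Or (Neg (rel_xy R)) (Exists vx [set vy] (Pos eq_yx)).

(* On [K], [g] after [f] equals [l] after [k].  As [x] is overwritten by the common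
   value, whether [y] was reached by [f] or by [k] must be read off [y]: by [P]. *)
Definition commute K P f g k l :=
  Or (Or (Neg (Rel1 K vx)) (And (Neg (rel_xy f)) (Neg (rel_xy k))))
     (Exists vx [set vy] (Or (And (Pos (Rel1 P vy)) (Pos g))
                             (And (Neg (Rel1 P vy)) (Pos l)))).

Definition when K f := Or (Neg (Rel1 K vx)) f.
Definition premise K R c :=
  when K (ex_y (And (Pos (rel_xy R)) (And (Pos (Rel1 (kind Call c) vy)) (Pos (Rel1 fresh
    vy))))).

(** The typing axioms supply the predicate [P] of [commute]: arguments and results are trees,
    premises are not, and [is_snd] separates the two premises. *)
Definition structural :=
  [:: functional car; functional cdr; functional arg; functional res; functional prev_step;
      when is_leaf (And (Neg (rel_xy car)) (Neg (rel_xy cdr)));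
      when fresh (Neg (rel_xy prev_step));
      Or (Neg (rel_xy arg)) (Pos (Rel1 is_tree vy));
      Or (Neg (rel_xy res)) (Pos (Rel1 is_tree vy));
      Or (Neg (rel_xy fst_)) (And (Neg (Rel1 is_tree vy)) (Neg (Rel1 is_snd vy)));
      Or (Neg (rel_xy snd_)) (And (Neg (Rel1 is_tree vy)) (Pos (Rel1 is_snd vy)));
      Or (Pos (Rel1 is_tree vx)) (And (ex_y (Pos (rel_xy arg))) (ex_y (Pos (rel_xy res))))].

(** The result cannot be compared directly with [R] of the argument: [arg] and [res] both lead to
    trees, which [is_tree] does not tell apart. Both sides are therefore compared with the result of
    a first premise that serves as a relay. *)
Definition projection K R :=
  [:: when K (ex_y (Pos (rel_xy fst_)));
      commute K is_tree arg (rel_yx R) fst_ (rel_yx res);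
      commute K is_tree res eq_yx fst_ (rel_yx res)].

Definition same_arg K R := commute K is_tree arg eq_yx R (rel_yx arg).

Definition sequence K :=
  [:: same_arg K fst_;
      commute K is_snd snd_ (rel_yx arg) fst_ (rel_yx res);
      commute K is_tree res eq_yx snd_ (rel_yx res)].

(** The second premise of a [Go] step is again a call of the loop and is not asked to be [fresh];
    every other premise introduced by [premise] is, so a nested loop starts with no previous
    iteration. *)
Definition step_axioms c :=
  let K := kind Call c in
  match c with
  | Id => [:: when K (Or (Neg (rel_xy arg)) (Pos (rel_xy res)))]
  | ConstLeaf => [:: when K (ex_y (And (Pos (rel_xy res)) (Pos (Rel1 is_leaf vy))))]
  | Car => projection K car
  | Cdr => projection K cdr
  | Pair c d =>
      [:: premise K fst_ c; premise K snd_ d; same_arg K fst_; same_arg K snd_;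
          commute K is_tree res (rel_yx car) fst_ (rel_yx res);
          commute K is_tree res (rel_yx cdr) snd_ (rel_yx res)]
  | Seq c d => [:: premise K fst_ c, premise K snd_ d & sequence K]
  | While c =>
      let S := kind Stop c in let G := kind Go c in
      [:: when K (Or (Pos (Rel1 S vx)) (Pos (Rel1 G vx))),
          when S (ex_y (And (Pos (rel_xy arg))
                            (ex_x (And (Pos (rel_yx car)) (Pos (Rel1 is_leaf vx)))))),
          when G (ex_y (And (Pos (rel_xy arg))
                            (ex_x (And (Pos (rel_yx car)) (ex_y (Pos (rel_xy car))))))),
          premise G fst_ c,
          when G (ex_y (And (Pos (rel_xy snd_)) (Pos (Rel1 K vy)))),
          when G (Or (Neg (rel_xy snd_)) (Pos (rel_yx prev_step)))
        & projection S cdr ++ sequence G]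
  end.

Fixpoint axioms c :=
  step_axioms c ++
  match c with
  | Pair c d | Seq c d => axioms c ++ axioms d
  | While c => axioms c
  | _ => [::]
  end.

Fixpoint all_full A (M : structure A) s :=
  if s is f :: s' then full M f /\ all_full M s' else True.

Lemma all_full_cat A (M : structure A) s t :
  all_full M (s ++ t) <-> all_full M s /\ all_full M t.
Proof. by elim: s => [|f s IH] /=; [split=> [|[]] | rewrite IH; tauto]. Qed.

(** * From a finite model to a terminating run *)

Section Soundness.

Variables (A : finType) (M : structure A).

Notation "R @1 x" := (rel1 M R x) (at level 50).
Notation r := (rel2 M).

Lemma fo_fullP f : full M f -> first_order f -> forall a b, holds M a b f.
Proof. by move=> Mf fo_f; apply/full_fo. Qed.

Lemma functionalP R : full M (functional R) ->
  forall a b c, r R a b -> r R a c -> b = c.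
Proof.
move=> /full_henkin H a b c ab ac; have [d Hd] := H isT isT a.
by case: (Hd b) => //= ->; case: (Hd c) => //= ->.
Qed.

Lemma commuteP K P f g k l : full M (commute K P f g k l) ->
  forall a b b', rel1 M K a -> r f a b -> rel1 M P b -> r k a b' -> ~ rel1 M P b' ->
  exists c, holds M c b (Pos g) /\ holds M c b' (Pos l).
Proof.
move=> /full_henkin H a b b' Ka fb Pb kb' Pb'; have [c Hc] := H isT isT a.
exists c; split.
  by case: (Hc b) => [[//|[//]]|[[]//|[]//]].
by case: (Hc b') => [[//|[//]]|[[]//|[]//]].
Qed.

Hypothesis structuralM : all_full M structural.

(** Inductive, so that under the structural axioms an element on a cycle of [car] and [cdr]
    represents no tree. *)
Inductive represents : A -> tree -> Prop :=
| represents_leaf a : rel1 M is_leaf a -> represents a Leaf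
| represents_node a b c t u : r car a b -> r cdr a c -> represents b t ->
    represents c u -> represents a (Node t u).

Lemma structuralP :
  [/\ [/\ forall a b c, r car a b -> r car a c -> b = c,
          forall a b c, r cdr a b -> r cdr a c -> b = c,
          forall a b c, r arg a b -> r arg a c -> b = c,
          forall a b c, r res a b -> r res a c -> b = c &
          forall a b c, r prev_step a b -> r prev_step a c -> b = c],
      [/\ forall a b, rel1 M is_leaf a -> ~ r car a b /\ ~ r cdr a b &
          forall a b, rel1 M fresh a -> ~ r prev_step a b],
      (forall a b, r arg a b -> rel1 M is_tree b) /\
      (forall a b, r res a b -> rel1 M is_tree b),
      (forall a b, r fst_ a b -> ~ rel1 M is_tree b /\ ~ rel1 M is_snd b) /\
      (forall a b, r snd_ a b -> ~ rel1 M is_tree b /\ rel1 M is_snd b) &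
      forall a, ~ rel1 M is_tree a -> (exists b, r arg a b) /\ (exists b, r res a b)].
Proof.
case: structuralM => /functionalP f0 [/functionalP f1 [/functionalP f2 [/functionalP f3
  [/functionalP f4]]]].
case=> /fo_fullP/(_ isT) h1 [/fo_fullP/(_ isT) h2 [/fo_fullP/(_ isT) h3 [/fo_fullP/(_ isT)
  h4]]].
case=> /fo_fullP/(_ isT) h5 [/fo_fullP/(_ isT) h6 [/fo_fullP h7 _]].
have h8 a : ~ rel1 M is_tree a -> (exists b, r arg a b) /\ (exists b, r res a b).
  by move=> na; case: (h7 _ a a) => [|//|//]; rewrite /= eqxx.
split; [by []| | | |exact: h8]; split=> a b.
- by move=> la; case: (h1 a b).
- by move=> fa; case: (h2 a b).
- by move=> ab; case: (h3 a b).
- by move=> ab; case: (h4 a b).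
- by move=> ab; case: (h5 a b).
- by move=> ab; case: (h6 a b).
Qed.

Lemma represents_leafP a : represents a Leaf -> rel1 M is_leaf a.
Proof. by move=> H; inversion H. Qed.

Lemma represents_nodeP a t u : represents a (Node t u) ->
  (exists b, r car a b) /\
  (forall b, r car a b -> represents b t) /\ (forall b, r cdr a b -> represents b u).
Proof.
have [[fcar fcdr _ _ _] _ _ _ _] := structuralP.
move=> H; inversion H as [|? b c ? ? ab ac bt cu]; subst.
split; first by exists b.
by split=> d ad; [rewrite (fcar _ _ _ ad ab) | rewrite (fcdr _ _ _ ad ac)].
Qed.

Lemma projectionP K R a d : all_full M (projection K R) ->
  rel1 M K a -> ~ rel1 M is_tree a -> r arg a d -> exists e, r R d e /\ r res a e.
Proof.
have [[_ _ _ fres _] _ [targ tres] [hfst _] total] := structuralP.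
case=> /fo_fullP h [h1 [h2 _]] Ka na ad; case: (h _ a a) => [|//|/=[s as_]].
  by rewrite /= eqxx.
have [ns _] := hfst _ _ as_; have [_ [y ay]] := total a na.
have [c [/= dc sc]] := commuteP h1 Ka ad (targ _ _ ad) as_ ns.
have [c' [/= yc sc']] := commuteP h2 Ka ay (tres _ _ ay) as_ ns.
by exists c; split=> //; rewrite (fres _ _ _ sc sc') -yc.
Qed.

Lemma premiseP K R c a : full M (premise K R c) -> rel1 M K a ->
  exists s, [/\ r R a s, rel1 M (kind Call c) s & rel1 M fresh s].
Proof.
move=> /fo_fullP h Ka; case: (h _ a a) => [|//|/=[s [? [? ?]]]].
  by rewrite /= eqxx.
by exists s.
Qed.

Lemma same_argP K R a s d : full M (same_arg K R) -> rel1 M K a -> r R a s ->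
  ~ rel1 M is_tree s -> r arg a d -> r arg s d.
Proof.
have [_ _ [targ _] _ _] := structuralP.
move=> h Ka as_ ns ad.
by have [c [/= -> ?]] := commuteP h Ka ad (targ _ _ ad) as_ ns.
Qed.

Lemma sequenceP K a s s' d : all_full M (sequence K) -> rel1 M K a ->
  ~ rel1 M is_tree a -> r fst_ a s -> r snd_ a s' -> r arg a d ->
  [/\ r arg s d, forall e, r res s e -> r arg s' e & forall e, r res s' e -> r res a e].
Proof.
have [[_ _ _ fres _] _ [targ tres] [hfst hsnd] total] := structuralP.
case=> h1 [h2 [h3 _]] Ka na as_ as' ad.
have [ns ms] := hfst _ _ as_; have [ns' ms'] := hsnd _ _ as'.
split; first exact: same_argP h1 Ka as_ ns ad.
  move=> e se; have [c [/= s'c sc]] := commuteP h2 Ka as' ms' as_ ms.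
  by rewrite (fres _ _ _ se sc).
move=> e s'e; have [_ [y ay]] := total a na.
have [c [/= yc s'c]] := commuteP h3 Ka ay (tres _ _ ay) as' ns'.
by rewrite (fres _ _ _ s'e s'c) -yc.
Qed.

Inductive depth : A -> nat -> Prop :=
| depth0 a : (forall b, ~ r prev_step a b) -> depth a 0
| depthS a b k : r prev_step a b -> depth b k -> depth a k.+1.

Lemma depth_fun a k l : depth a k -> depth a l -> k = l.
Proof.
have [[_ _ _ _ fprev] _ _ _ _] := structuralP.
move=> H; elim: H l => {a k} [a na|a b k ab _ IH] l H.
  by inversion H as [|? b ? ab]; subst => //; case: (na b).
inversion H as [? na|? b' ? ab' Hb']; subst; first by case: (na b).
by congr S; apply: IH; rewrite (fprev _ _ _ ab ab').
Qed.

(** All depths up to [k] occur along the chain of previous iterations, and uniqueness of the depth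
    makes the elements distinct. Finiteness of the structure enters here. *)
Lemma depth_lt a k : depth a k -> k < #|A|.
Proof.
move=> H; have below i : i <= k -> exists b, depth b i.
  elim: H i => {a k} [a na|a b k ab bk IH] i; last rewrite leq_eqVlt => /orP[/eqP->|/IH//].
    by rewrite leqn0 => /eqP->; exists a; apply: depth0.
  by exists a; apply: depthS bk.
have ex (i : 'I_k.+1) : exists b, depth b i by apply: below; rewrite -ltnS.
have [f Hf] := choice ex; rewrite -[k.+1]card_ord; apply: (leq_card f) => i j E.
by apply/val_inj/(depth_fun (Hf i)); rewrite E.
Qed.

Theorem soundness c : all_full M (axioms c) -> forall a d t,
  rel1 M (kind Call c) a -> rel1 M fresh a -> ~ rel1 M is_tree a ->
  r arg a d -> represents d t ->
  exists e y, [/\ r res a e, represents e y & runs c t y].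
Proof.
have [[fcar fcdr farg fres _] [leafP freshP] [targ tres] [hfst hsnd] total] := structuralP.
elim: c => [||||c IHc c' IHc'|c IHc c' IHc'|c IHc].
- case=> /fo_fullP/(_ isT) h _ a d t Ka _ na ad dt.
  exists d, t; split=> //; case: (h a d) => [//|]; by case.
- case=> /fo_fullP h _ a d t Ka _ na ad dt.
  case: (h _ a a) => [|//|/=[e [ae le]]]; first by rewrite /= eqxx.
  by exists e, Leaf; split=> //; apply: represents_leaf.
- move=> /all_full_cat[h _] a d t Ka _ na ad dt.
  have [e [de ae]] := projectionP h Ka na ad.
  case: t dt => [/represents_leafP/(leafP _ e)[]//|t u /represents_nodeP[_ [/(_ _ de) et _]]].
  by exists e, t; split=> //; exists u.
- move=> /all_full_cat[h _] a d t Ka _ na ad dt.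
  have [e [de ae]] := projectionP h Ka na ad.
  case: t dt => [/represents_leafP/(leafP _ e)[]//|t u /represents_nodeP[_ [_ /(_ _ de) eu]]].
  by exists e, u; split=> //; exists t.
- case=> p1 [p2 [a1 [a2 [h1 [h2 /all_full_cat[ax ax']]]]]] a d t Ka _ na ad dt.
  have [s [as_ Ks fs]] := premiseP p1 Ka; have [ns _] := hfst _ _ as_.
  have [s' [as' Ks' fs']] := premiseP p2 Ka; have [ns' _] := hsnd _ _ as'.
  have [e [y [se ey cy]]] := IHc ax _ _ _ Ks fs ns (same_argP a1 Ka as_ ns ad) dt.
  have [e' [y' [se' ey' cy']]] := IHc' ax' _ _ _ Ks' fs' ns' (same_argP a2 Ka as' ns' ad) dt.
  have [_ [z az]] := total a na.
  have [x1 [/= zx1 sx1]] := commuteP h1 Ka az (tres _ _ az) as_ ns.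
  have [x2 [/= zx2 sx2]] := commuteP h2 Ka az (tres _ _ az) as' ns'.
  exists z, (Node y y'); split=> //; last by exists y, y'.
  by apply: represents_node zx1 zx2 _ _; rewrite ?(fres _ _ _ sx1 se) ?(fres _ _ _ sx2 se').
- case=> p1 [p2 [h1 [h2 [h3 /all_full_cat[ax ax']]]]] a d t Ka _ na ad dt.
  have [s [as_ Ks fs]] := premiseP p1 Ka; have [ns _] := hfst _ _ as_.
  have [s' [as' Ks' fs']] := premiseP p2 Ka; have [ns' _] := hsnd _ _ as'.
  have [sd ss' s'a] := sequenceP (conj h1 (conj h2 (conj h3 I))) Ka na as_ as' ad.
  have [e [y [se ey cy]]] := IHc ax _ _ _ Ks fs ns sd dt.
  have [e' [y' [se' ey' cy']]] := IHc' ax' _ _ _ Ks' fs' ns' (ss' _ se) ey.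
  by exists e', y'; split=> //; [exact: s'a | exists y].
- case=> /fo_fullP/(_ isT) h1 [/fo_fullP h2 [/fo_fullP h3 [p1 [/fo_fullP h4]]]].
  case=> /fo_fullP/(_ isT) h5 [hs1 [hs2 [hs3 [hg1 [hg2 [hg3 ax]]]]]].
  (* [fuel] bounds the iterations still possible: each one increases the depth, which stays below
     [#|A|]. *)
  suff main fuel a k d t : depth a k -> #|A| <= k + fuel -> rel1 M (kind Call (While c)) a ->
      ~ rel1 M is_tree a -> r arg a d -> represents d t ->
      exists e y, [/\ r res a e, represents e y & loop (runs c) t y].
    move=> a d t Ka fa; apply: (main #|A| a 0) => //.
    by apply: depth0 => b; apply: freshP.
  elim: fuel a k d t => [|fuel IH] a k d t dk le_k Ka na ad dt.
    by have := depth_lt dk; rewrite ltnNge -{1}(addn0 k) le_k.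
  case: (h1 a a) => [//|[]] /= Ra.
    have [e [de ae]] := projectionP (conj hs1 (conj hs2 (conj hs3 I))) Ra na ad.
    case: (h2 _ a a) => [|//|/= [d' [ad' [x [d'x lx]]]]]; first by rewrite /= eqxx.
    rewrite (farg _ _ _ ad' ad) in d'x.
    case: t dt => [/represents_leafP/(leafP _ e)[]//|t u /represents_nodeP[_ [/(_ _ d'x) xt
      /(_ _ de) eu]]].
    (* The test element is a leaf and so has no [car], which excludes that it represents a node. *)
    exists e, u; split=> //; case: t xt => [_|t t' /represents_nodeP[[b xb]]].
      exact: loop_stop.
    by case: (leafP x b lx).
  case: (h3 _ a a) => [|//|/= [d' [ad' [x [d'x [x' xx']]]]]]; first by rewrite /= eqxx.
  rewrite (farg _ _ _ ad' ad) in d'x.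
  have [s [as_ Ks fs]] := premiseP p1 Ra; have [ns _] := hfst _ _ as_.
  case: (h4 _ a a) => [|//|/=[s' [as' Ks']]]; first by rewrite /= eqxx.
  have [ns' _] := hsnd _ _ as'.
  have [sd ss' s'a] := sequenceP (conj hg1 (conj hg2 (conj hg3 I))) Ra na as_ as' ad.
  have [e [y [se ey cy]]] := IHc ax _ _ _ Ks fs ns sd dt.
  have ps' : r prev_step s' a by case: (h5 a s') => //= -[].
  have [|e' [y' [se' ey' cy']]] := IH _ _ _ _ (depthS ps' dk) _ Ks' ns' (ss' _ se) ey.
    by rewrite addSnnS.
  exists e', y'; split=> //; first exact: s'a.
  case: t dt cy {sd} => [/represents_leafP/(leafP _ x)[]//|t u /represents_nodeP[_ [/(_ _
    d'x) xt _]] cy].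
  case: t xt cy => [/represents_leafP/(leafP _ x')[]//|t t' _ cy].
  exact: loop_go cy cy'.
Qed.
End Soundness.

(** * The structure of a terminating run *)

(** The equation [Eq vx vy] moves the tail from [vy] back to [vx], so two variables suffice for
    every [n]. The recursive call comes last, which keeps the encoding easy to compute. *)
Fixpoint numeral n :=
  if n is m.+1 then
    And (ex_y (And (Pos (rel_xy car)) (Pos (Rel1 is_leaf vy))))
        (ex_y (And (Pos (rel_xy cdr)) (ex_x (And (Pos (Eq vx vy)) (numeral m)))))
  else Pos (Rel1 is_leaf vx).

(** The numeral is placed at the very end, so that [n] affects only the last part of the
    encoding. *)
Definition start c n :=
  ex_x (And (And (Pos (Rel1 (kind Call c) vx))
                 (And (Pos (Rel1 fresh vx)) (Neg (Rel1 is_tree vx))))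
    (ex_y (And (Pos (rel_xy arg))
      (And (ex_x (And (Pos (rel_yx cdr)) (Pos (Rel1 is_leaf vx))))
           (ex_x (And (Pos (rel_yx car)) (numeral n))))))).

Definition conj_all s := foldr And (Pos (Eq vx vx)) s.

Definition halting_sentence c n :=
  Forall vx (Forall vy (And (conj_all (structural ++ axioms c)) (start c n))).

Lemma full_and A (M : structure A) f g :
  full M (And f g) <-> full M f /\ full M g.
Proof. by []. Qed.

Lemma full_conj_all A (M : structure A) s : full M (conj_all s) <-> all_full M s.
Proof.
elim: s => [|f s IH] /=; last by rewrite -IH.
by split=> // _; apply/full_fo.
Qed.

Lemma first_order_numeral n : first_order (numeral n).
Proof. by elim: n => //= n ->; rewrite !eqxx. Qed.

Lemma truth_halting_sentence A (M : structure A) c n :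
  truth M (halting_sentence c n) <->
  [/\ all_full M structural, all_full M (axioms c) & forall a b, holds M a b (start c n)].
Proof.
have fo_start : first_order (start c n) by rewrite /= first_order_numeral !eqxx.
rewrite truth_full; split.
  case/full_and=> /full_conj_all/all_full_cat[st ax] H.
  by split=> //; apply/(full_fo _ fo_start).
case=> st ax H; apply/full_and; split; last exact/(full_fo _ fo_start).
exact/full_conj_all/all_full_cat.
Qed.

Lemma numeral_represents (A : finType) (M : structure A) n a b :
  holds M a b (numeral n) -> represents M a (num_tree n).
Proof.
elim: n a b => [|n IH] a b /=; first exact: represents_leaf.
case=> -[d [ad ld]] [e [ae [e' [-> /IH en]]]].
exact: represents_node ad ae (represents_leaf ld) en.
Qed.

Lemma halting_sentence_sound (A : finType) (M : structure A) c n :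
  truth M (halting_sentence c n) -> exists y, runs c (tup [:: n]) y.
Proof.
case/truth_halting_sentence => st ax /=; have [a0] := nonempty M.
move=> /(_ a0 a0)[a [[Ka [fa na]] [d [ad [[e [de le]] [e' [de' /numeral_represents e'n]]]]]]].
have [_ [y [_ _ cy]]] := soundness st ax Ka fa na ad
  (represents_node de' de e'n (represents_leaf le)).
by exists y.
Qed.

(** * Derivation trees of runs *)

HB.instance Definition _ := gen_eqMixin tree.
HB.instance Definition _ := gen_choiceMixin tree.

Definition label := option (comb * tree * tree).

Definition has_res (l : label) y := exists c t, l = Some (c, t, y).

(* A label is a program with its input and output; [l0] and [l1] label the premises
   of a step labelled [l]. *)
Definition justified (l l0 l1 : label) : Prop :=
  if l is Some (c, t, y) then
    match c with
    | Id => y = t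
    | ConstLeaf => y = Leaf
    | Car => (exists u, t = Node y u) /\ has_res l0 y
    | Cdr => (exists u, t = Node u y) /\ has_res l0 y
    | Pair c d => exists a b,
        [/\ l0 = Some (c, t, a), l1 = Some (d, t, b) & y = Node a b]
    | Seq c d => exists a, l0 = Some (c, t, a) /\ l1 = Some (d, a, y)
    | While c => t = Node Leaf y /\ has_res l0 y \/
        exists a b z s, [/\ t = Node (Node a b) z, l0 = Some (c, t, s)
          & l1 = Some (While c, s, y)]
    end
  else True.

(* The steps of a computation are named by paths in its derivation tree. *)
Definition derivation (l : seq bool -> label) (D : seq (seq bool)) :=
  (forall p, justified (l p) (l (rcons p false)) (l (rcons p true))) /\
  (forall p, p \in D <-> l p <> None).

Definition derives (e : label) := exists l D, l [::] = e /\ derivation l D.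

Lemma derives_none : derives None.
Proof. by exists (fun=> None), [::]; split=> //; split=> // p; split. Qed.

(** The two derivations are grafted under a new root by prefixing their paths with [false] and
    [true]. *)
Lemma derives_node c t y e0 e1 : justified (Some (c, t, y)) e0 e1 ->
  derives e0 -> derives e1 -> derives (Some (c, t, y)).
Proof.
move=> J [l0 [D0 [E0 [J0 H0]]]] [l1 [D1 [E1 [J1 H1]]]].
exists (fun p => match p with [::] => Some (c, t, y) | false :: q => l0 q | true :: q => l1
  q end).
exists ([::] :: map (cons false) D0 ++ map (cons true) D1); split=> //; split.
  by case=> [|[] p] /=; [rewrite E0 E1 | apply: J1 | apply: J0].
have inj b : injective (cons b : seq bool -> seq bool) by move=> p q [].
have notin b (D : seq (seq bool)) p : (~~ b :: p \in map (cons b) D) = false.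
  by apply/negbTE/mapP => -[q _] []; case: b.
case=> [|[] p]; rewrite !inE //= mem_cat.
  by rewrite (notin false) mem_map // -H1.
by rewrite (notin true) orbF mem_map // -H0.
Qed.

Lemma derives_runs c t y : runs c t y -> derives (Some (c, t, y)).
Proof.
(* The relay demanded by [projection]: an [Id] step that returns the required result. *)
have idle z : derives (Some (Id, z, z)) by apply: (derives_node _ derives_none derives_none).
elim: c t y => [||||c IHc d IHd|c IHc d IHd|c IHc] t y.
- by move=> ->.
- by move=> ->; apply: (derives_node _ derives_none derives_none).
- move=> H; apply: (derives_node _ (idle y) derives_none) => /=.
  by split=> //; exists Id, y.
- move=> H; apply: (derives_node _ (idle y) derives_none) => /=.
  by split=> //; exists Id, y.
- case=> a [b [/IHc Ha /IHd Hb ->]]; apply: (derives_node _ Ha Hb).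
  by exists a, b.
- by case=> a /IHc Ha /IHd Hb; apply: (derives_node _ Ha Hb); exists a.
- elim=> {t y} [y|a b z s y /IHc Hs _ Hl].
    by apply: (derives_node _ (idle y) derives_none); left; split=> //; exists Id, y.
  by apply: (derives_node _ Hs Hl); right; exists a, b, z, s.
Qed.

Fixpoint subtrees t := t :: (if t is Node u v then subtrees u ++ subtrees v else [::]).

Lemma subtrees_self t : t \in subtrees t.
Proof. by case: t => *; rewrite inE eqxx. Qed.

Lemma subtrees_node t u v : Node u v \in subtrees t ->
  u \in subtrees t /\ v \in subtrees t.
Proof.
elim: t => [|a IHa b IHb]; first by rewrite inE => /eqP.
rewrite /= !inE !mem_cat => /or3P[/eqP[-> ->]|/IHa[-> ->]|/IHb[-> ->]]; rewrite ?orbT //.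
by rewrite !subtrees_self /= !orbT.
Qed.


(** * The model of a derivation *)

Section Model.

Variables (l : seq bool -> label) (D : seq (seq bool)) (c0 : comb) (t0 y0 : tree).
Hypothesis l_root : l [::] = Some (c0, t0, y0).
Hypothesis l_derivation : derivation l D.

Definition label_trees (e : label) :=
  if e is Some (_, t, y) then subtrees t ++ subtrees y else [::].
Definition trees := flatten (map (label_trees \o l) D).

(** Steps are kept apart by their paths, whereas a tree is a single element wherever it occurs, so
    that equal results are equal elements as [commute] demands. *)
Definition elements : seq (seq bool + tree) := map inl D ++ map inr trees.
Definition universe : finType := seq_sub elements.

Definition looped r c := if r is Call then c else While c.
Definition shape r t : Prop :=
  match r with
  | Call => True
  | Stop => exists u, t = Node Leaf u
  | Go => exists a b z, t = Node (Node a b) z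
  end.
Definition goes (e : label) := exists c t y, e = Some (While c, t, y) /\ shape Go t.

Definition unary i (v : seq bool + tree) : Prop :=
  match i with
  | 0 => v = inr Leaf
  | 1 => exists t, v = inr t
  | 2 => exists p, v = inl (rcons p true)
  | 3 => ~ exists p, v = inl (rcons p true) /\ goes (l p)
  | _ => exists r c p t y,
      [/\ i = kind r c, v = inl p, l p = Some (looped r c, t, y) & shape r t]
  end.

Definition binary j (v w : seq bool + tree) : Prop :=
  match j with
  | 0 => exists t u, v = inr (Node t u) /\ w = inr t
  | 1 => exists t u, v = inr (Node t u) /\ w = inr u
  | 2 => exists p c t y, [/\ v = inl p, l p = Some (c, t, y) & w = inr t]
  | 3 => exists p c t y, [/\ v = inl p, l p = Some (c, t, y) & w = inr y]
  | 4 => exists p, v = inl p /\ w = inl (rcons p false)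
  | 5 => exists p, v = inl p /\ w = inl (rcons p true)
  | _ => exists p, [/\ v = inl (rcons p true), w = inl p & goes (l p)]
  end.

Lemma step_element p : l p <> None -> exists a : universe, ssval a = inl p.
Proof.
move=> lp; have pL : inl p \in elements.
  by rewrite mem_cat map_f //; apply/l_derivation.2.
by exists (SeqSub pL).
Qed.

Lemma tree_element t : t \in trees -> exists a : universe, ssval a = inr t.
Proof.
move=> tT; have tL : inr t \in elements by rewrite mem_cat map_f ?orbT.
by exists (SeqSub tL).
Qed.

Lemma element_step (a : universe) p : ssval a = inl p -> exists c t y, l p = Some (c, t, y).
Proof.
move=> ap; have := ssvalP a; rewrite ap mem_cat => /orP[]; last by case/mapP.
case/mapP => q qD [->]; have := (l_derivation.2 q).1 qD.
by case: (l q) => // -[[c t] y] _; exists c, t, y.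
Qed.

Lemma element_tree (a : universe) t : ssval a = inr t -> t \in trees.
Proof.
move=> at_; have := ssvalP a; rewrite at_ mem_cat => /orP[]; first by case/mapP.
by case/mapP => u uT [->].
Qed.

Lemma trees_label p c t y : l p = Some (c, t, y) -> t \in trees /\ y \in trees.
Proof.
move=> lp; have pD : p \in D by apply/l_derivation.2; rewrite lp.
by split; apply/flatten_mapP; exists p; rewrite //= lp mem_cat subtrees_self ?orbT.
Qed.

Lemma trees_node t u : Node t u \in trees -> t \in trees /\ u \in trees.
Proof.
case/flatten_mapP => p pD /=; case Ep: (l p) => [[[c a] b]|] //=.
rewrite mem_cat => /orP[/subtrees_node[? ?]|/subtrees_node[? ?]].
  by split; apply/flatten_mapP; exists p => //=; rewrite Ep mem_cat; apply/orP; left.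
by split; apply/flatten_mapP; exists p => //=; rewrite Ep mem_cat; apply/orP; right.
Qed.

Lemma universe_nonempty : inhabited universe.
Proof. by have [|a _] := step_element (p := [::]); rewrite ?l_root. Qed.

Definition model : structure universe := Structure universe_nonempty
  (fun i a => unary i (ssval a)) (fun j a b => binary j (ssval a) (ssval b)).

Local Notation node a p := (ssval a = inl p).
Local Notation data a t := (ssval a = inr t).

Lemma universe_inj (a b : universe) : ssval a = ssval b -> a = b.
Proof. exact: val_inj. Qed.

Lemma kindP r c (a : universe) : rel1 model (kind r c) a <->
  exists p t y, [/\ node a p, l p = Some (looped r c, t, y) & shape r t].
Proof.
split; last by case=> p [t [y [? ? ?]]]; exists r, c, p, t, y.
by case=> r' [c' [p [t [y [/kind_inj[-> ->] ? ? ?]]]]]; exists p, t, y.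
Qed.

Lemma argP a b p c t y : node a p -> l p = Some (c, t, y) ->
  rel2 model arg a b <-> data b t.
Proof.
move=> ap lp; split; last by exists p, c, t, y.
by case=> q [c' [t' [y' []]]]; rewrite ap => -[<-]; rewrite lp => -[_ <- _].
Qed.

Lemma resP a b p c t y : node a p -> l p = Some (c, t, y) ->
  rel2 model res a b <-> data b y.
Proof.
move=> ap lp; split; last by exists p, c, t, y.
by case=> q [c' [t' [y' []]]]; rewrite ap => -[<-]; rewrite lp => -[_ _ <-].
Qed.

Lemma fstP a b p : node a p -> rel2 model fst_ a b <-> node b (rcons p false).
Proof.
by move=> ap; split=> [[q []]|]; [rewrite ap => -[<-] | exists p].
Qed.

Lemma sndP a b p : node a p -> rel2 model snd_ a b <-> node b (rcons p true).
Proof.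
by move=> ap; split=> [[q []]|]; [rewrite ap => -[<-] | exists p].
Qed.

Lemma node_tree a p : node a p -> ~ rel1 model is_tree a.
Proof. by move=> ap [t]; rewrite ap. Qed.

Lemma full_when K f : first_order f ->
  (forall a b, rel1 model K a -> holds model a b f) -> full model (when K f).
Proof.
move=> fo_f H; apply/full_fo => // a b.
by have [/H|] := pselect (rel1 model K a); [right | left].
Qed.

Lemma full_functional R : (forall a b c, rel2 model R a b -> rel2 model R a c -> b = c) ->
  full model (functional R).
Proof.
move=> H; apply/full_henkin => // a.
have [[b ab]|nR] := pselect (exists b, rel2 model R a b).
  exists b => c; have [ac|] := pselect (rel2 model R a c); last by left.
  by right; apply: H ac ab.
by exists a => b; left => ab; case: nR; exists b.
Qed.

(** The witness [c] is the common end of the two paths; pairs reached by neither path go to the left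
    disjunct. *)
Lemma full_commute K P f g k g' :
  (forall a, rel1 model K a -> exists c,
     (forall b, rel2 model f a b -> rel1 model P b /\ holds model c b (Pos g)) /\
     (forall b, rel2 model k a b -> ~ rel1 model P b /\ holds model c b (Pos g'))) ->
  full model (commute K P f g k g').
Proof.
move=> H; apply/full_henkin => // a.
have [/H[c [Hf Hk]]|nK] := pselect (rel1 model K a); last by exists a => b; left; left.
exists c => b; have [fb|nf] := pselect (rel2 model f a b).
  by right; left; apply: Hf.
have [kb|nk] := pselect (rel2 model k a b); last by left; right.
by right; right; apply: Hk.
Qed.

Lemma all_full_structural : all_full model structural.
Proof.
have nd (a b : universe) x : ssval a = x -> ssval b = x -> a = b.
  by move=> ax bx; apply: universe_inj; rewrite ax bx.
split; first by apply: full_functional => a b c [t [u [at_ bt]]] [t' [u' []]];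
  rewrite at_ => -[<- _]; apply: nd.
split; first by apply: full_functional => a b c [t [u [at_ bt]]] [t' [u' []]];
  rewrite at_ => -[_ <-]; apply: nd.
split; first by apply: full_functional => a b c [p [c' [t [y [ap lp bt]]]]] /(argP _ ap lp);
  apply: nd.
split; first by apply: full_functional => a b c [p [c' [t [y [ap lp bt]]]]] /(resP _ ap lp);
  apply: nd.
split.
  apply: full_functional => a b c [p [ap bp _]] [q []].
  by rewrite ap => -[/rcons_inj[<-]] cp _; apply: nd bp cp.
split; first by apply: full_when => // a b la; split=> -[t [u []]] /=;
  rewrite (la : ssval a = _).
split.
  apply: full_when => // a b fa [p [ap bp gp]]; apply: fa.
  by exists p.
split.
  apply/full_fo => // a b; have [|] := pselect (rel2 model arg a b); last by left.
  by case=> p [c [t [y [_ _ bt]]]]; right; exists t.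
split.
  apply/full_fo => // a b; have [|] := pselect (rel2 model res a b); last by left.
  by case=> p [c [t [y [_ _ bt]]]]; right; exists y.
split.
  apply/full_fo => // a b; have [|] := pselect (rel2 model fst_ a b); last by left.
  case=> p [_ bp]; right; split; first by case=> t; rewrite /= bp.
  by case=> q; rewrite /= bp => -[/rcons_inj[]].
split.
  apply/full_fo => // a b; have [|] := pselect (rel2 model snd_ a b); last by left.
  by case=> p [_ bp]; right; split; [case=> t; rewrite /= bp | exists p].
split=> //; apply/full_fo; first by rewrite /= eqxx.
move=> a b /=; case va: (ssval a) => [p|t]; last by left; exists t.
right; have [c [t [y lp]]] := element_step va; have [tT yT] := trees_label lp.
have [d dt] := tree_element tT; have [e ey] := tree_element yT.
by split; [exists d | exists e]; exists p, c, t, y.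
Qed.

Lemma full_projection K R : (forall a, rel1 model K a -> exists p c t y,
    [/\ node a p, l p = Some (c, t, y), has_res (l (rcons p false)) y &
        forall d e, data d t -> data e y -> rel2 model R d e]) ->
  all_full model (projection K R).
Proof.
move=> H; split; last split; last split=> //.
- apply: full_when => [|a a0 /H[p [c [t [y [ap _ [c' [t' lp0]] _]]]]]];
    first by rewrite /= eqxx.
  have [|b bp] := step_element (p := rcons p false); first by rewrite lp0.
  by exists b; apply: (fstP b ap).2.
- apply: full_commute => a /H[p [c [t [y [ap lp [c' [t' lp0]] HR]]]]].
  have [tT yT] := trees_label lp; have [e ey] := tree_element yT.
  exists e; split=> b.
    by move/(argP _ ap lp) => bt; split; [exists t | apply: HR].
  by move/(fstP _ ap) => bp; split; [apply: node_tree bp | apply: (resP e bp lp0).2].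
- apply: full_commute => a /H[p [c [t [y [ap lp [c' [t' lp0]] HR]]]]].
  have [tT yT] := trees_label lp; have [e ey] := tree_element yT.
  exists e; split=> b.
    by move/(resP _ ap lp) => by_; split; [exists y | apply: universe_inj; rewrite /= by_].
  by move/(fstP _ ap) => bp; split; [apply: node_tree bp | apply: (resP e bp lp0).2].
Qed.

(** [fresh] fails exactly at the second premise of an iterating loop step; the condition on [b]
    excludes that case. *)
Lemma full_premise K R c b : R = (if b then snd_ else fst_) ->
  (forall a, rel1 model K a -> exists p t y,
    [/\ node a p, l (rcons p b) = Some (c, t, y) & b -> ~ goes (l p)]) ->
  full model (premise K R c).
Proof.
move=> ER H; apply: full_when => [|a a0 /H[p [t [y [ap lpb ng]]]]]; first by rewrite /= eqxx.
have [|s sp] := step_element (p := rcons p b); first by rewrite lpb.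
exists s; split; first by rewrite ER; case: (b) sp => sp;
  [apply: (sndP s ap).2 | apply: (fstP s ap).2].
split; first by apply: (kindP Call c s).2; exists (rcons p b), t, y.
by case=> q; rewrite /= sp => -[[/rcons_inj[<- Eb]]]; apply: ng.
Qed.

Lemma full_same_arg K b : (forall a, rel1 model K a -> exists p c t y c' y',
    [/\ node a p, l p = Some (c, t, y) & l (rcons p b) = Some (c', t, y')]) ->
  full model (same_arg K (if b then snd_ else fst_)).
Proof.
move=> H; apply: full_commute => a /H[p [c [t [y [c' [y' [ap lp lpb]]]]]]].
have [tT _] := trees_label lp; have [d dt] := tree_element tT.
exists d; split=> s.
  by move/(argP _ ap lp) => st; split; [exists t | apply: universe_inj; rewrite /= st].
move=> as_; have sp : node s (rcons p b).
  by case: (b) as_ => as_; [apply/(sndP s ap) | apply/(fstP s ap)].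
by split; [apply: node_tree sp | apply: (argP d sp lpb).2].
Qed.

Lemma full_sequence K : (forall a, rel1 model K a -> exists p c t y c1 s c2,
    [/\ node a p, l p = Some (c, t, y), l (rcons p false) = Some (c1, t, s) &
        l (rcons p true) = Some (c2, s, y)]) ->
  all_full model (sequence K).
Proof.
move=> H; split; last split; last split=> //.
- apply: (@full_same_arg K false) => a /H[p [c [t [y [c1 [s [c2 [ap lp lp0 lp1]]]]]]]].
  by exists p, c, t, y, c1, s.
- apply: full_commute => a /H[p [c [t [y [c1 [s [c2 [ap lp lp0 lp1]]]]]]]].
  have [sT _] := trees_label lp1; have [d ds] := tree_element sT.
  exists d; split=> b.
    by move/(sndP b ap) => bp; split; [exists p | apply: (argP d bp lp1).2].
  move/(fstP b ap) => bp; split; last exact: (resP d bp lp0).2.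
  by case=> q; rewrite /= bp => -[/rcons_inj[]].
- apply: full_commute => a /H[p [c [t [y [c1 [s [c2 [ap lp lp0 lp1]]]]]]]].
  have [_ yT] := trees_label lp; have [e ey] := tree_element yT.
  exists e; split=> b.
    by move/(resP _ ap lp) => by_; split; [exists y | apply: universe_inj; rewrite /= by_].
  by move/(sndP b ap) => bp; split; [apply: node_tree bp | apply: (resP e bp lp1).2].
Qed.

Lemma callP c a : rel1 model (kind Call c) a -> exists p t y,
  [/\ node a p, l p = Some (c, t, y) &
      justified (Some (c, t, y)) (l (rcons p false)) (l (rcons p true))].
Proof.
case/kindP => p [t [y [ap lp _]]]; exists p, t, y; split=> //.
by have := l_derivation.1 p; rewrite lp.
Qed.

Lemma full_step_axioms c : all_full model (step_axioms c).
Proof.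
case: c => [||||c d|c d|c].
- split=> //; apply: full_when => // a b /callP[p [t [y [ap lp /= ty]]]] /=.
  have [|] := pselect (rel2 model arg a b); last by left.
  by move/(argP b ap lp) => bt; right; apply: (resP b ap lp).2; rewrite ty.
- split=> //; apply: full_when => [|a b /callP[p [t [y [ap lp /= yl]]]]];
    first by rewrite /= eqxx.
  have [_ yT] := trees_label lp; have [e ey] := tree_element yT.
  by exists e; split; [apply: (resP e ap lp).2 | rewrite /= ey yl].
- apply: full_projection => a /callP[p [t [y [ap lp [[u tu] hr]]]]].
  exists p, Car, t, y; split=> // d e dt ey.
  by exists y, u; rewrite dt tu.
- apply: full_projection => a /callP[p [t [y [ap lp [[u tu] hr]]]]].
  exists p, Cdr, t, y; split=> // d e dt ey.
  by exists u, y; rewrite dt tu.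
- split; first apply: (@full_premise _ _ _ false) => // a /callP[p [t [y [ap lp [u [v [lp0
    lp1 E]]]]]]].
    by exists p, t, u.
  split; first apply: (@full_premise _ _ _ true) => // a /callP[p [t [y [ap lp [u [v [lp0
    lp1 E]]]]]]].
    by exists p, t, v; split=> // _ [c' [t' [y']]]; rewrite lp => -[].
  split; first apply: (@full_same_arg _ false) => // a /callP[p [t [y [ap lp [u [v [lp0 lp1
    E]]]]]]].
    by exists p, (Pair c d), t, y, c, u.
  split; first apply: (@full_same_arg _ true) => // a /callP[p [t [y [ap lp [u [v [lp0 lp1
    E]]]]]]].
    by exists p, (Pair c d), t, y, d, v.
  split; last split=> //.
    apply: full_commute => a /callP[p [t [y [ap lp [u [v [lp0 lp1 E]]]]]]].
    have [_ uT] := trees_label lp0; have [e eu] := tree_element uT; exists e; split=> b.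
      move/(resP b ap lp) => by_; split; first by exists y.
      by exists u, v; rewrite by_ E.
    move/(fstP b ap) => bp; split; first exact: node_tree bp.
    exact: (resP e bp lp0).2.
  apply: full_commute => a /callP[p [t [y [ap lp [u [v [lp0 lp1 E]]]]]]].
  have [_ vT] := trees_label lp1; have [e ev] := tree_element vT; exists e; split=> b.
    move/(resP b ap lp) => by_; split; first by exists y.
    by exists u, v; rewrite by_ E.
  move/(sndP b ap) => bp; split; first exact: node_tree bp.
  exact: (resP e bp lp1).2.
- split; first apply: (@full_premise _ _ _ false) => // a /callP[p [t [y [ap lp [s [lp0
    lp1]]]]]].
    by exists p, t, s.
  split; first apply: (@full_premise _ _ _ true) => // a /callP[p [t [y [ap lp [s [lp0
    lp1]]]]]].
    by exists p, s, y; split=> // _ [c' [t' [y']]]; rewrite lp => -[].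
  apply: full_sequence => a /callP[p [t [y [ap lp [s [lp0 lp1]]]]]].
  by exists p, (Seq c d), t, y, c, s, d.
(* For a loop step the shape of the argument decides which alternative of [justified] applies. *)
- have stopP a : rel1 model (kind Stop c) a -> exists p y,
      [/\ node a p, l p = Some (While c, Node Leaf y, y) & has_res (l (rcons p false)) y].
    case/kindP => p [t [y [ap lp [u tu]]]]; exists p, y.
    have := l_derivation.1 p; rewrite lp /= tu => -[[[uy] hr]|[a' [b' [z [s []]]]]] //.
    by rewrite uy.
  have goP a : rel1 model (kind Go c) a -> exists p t y s,
      [/\ node a p, l p = Some (While c, t, y) /\ shape Go t,
          l (rcons p false) = Some (c, t, s) & l (rcons p true) = Some (While c, s, y)].
    case/kindP => p [t [y [ap lp sh]]]; have [a1 [b1 [z1 Et]]] := sh.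
    have := l_derivation.1 p; rewrite lp /= Et => -[[]|[a' [b' [z [s [_ lp0 lp1]]]]]] //.
    by exists p, t, y, s; rewrite Et; split=> //; rewrite -Et.
  split.
    apply: full_when => // a a0 /callP[p [t [y [ap lp]]]].
    case=> [[ty _]|[a' [b' [z [s [tz _ _]]]]]]; [left|right].
      by apply: (kindP Stop c a).2; exists p, t, y; split=> //; exists y.
    by apply: (kindP Go c a).2; exists p, t, y; split=> //; exists a', b', z.
  split.
    apply: full_when => [|a a0 /stopP[p [y [ap lp _]]]]; first by rewrite /= !eqxx.
    have [tT _] := trees_label lp; have [d dt] := tree_element tT.
    have [LT _] := trees_node tT; have [e eL] := tree_element LT.
    exists d; split; first exact: (argP d ap lp).2.
    by exists e; split=> //; exists Leaf, y.
  split.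
    apply: full_when => [|a a0 /goP[p [t [y [s [ap [lp [u [v [z tz]]]] _ _]]]]]].
      by rewrite /= !eqxx.
    have [tT _] := trees_label lp; have [d dt] := tree_element tT; rewrite tz in tT.
    have [uvT _] := trees_node tT; have [e euv] := tree_element uvT.
    have [uT _] := trees_node uvT; have [x xu] := tree_element uT.
    exists d; split; first exact: (argP d ap lp).2.
    exists e; split; first by exists (Node u v), z; rewrite dt tz.
    by exists x; exists u, v.
  split.
    apply: (@full_premise _ _ _ false) => // a /goP[p [t [y [s [ap _ lp0 _]]]]].
    by exists p, t, s.
  split.
    apply: full_when => [|a a0 /goP[p [t [y [s [ap _ _ lp1]]]]]]; first by rewrite /= eqxx.
    have [|b bp] := step_element (p := rcons p true); first by rewrite lp1.
    exists b; split; first exact: (sndP b ap).2.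
    by apply: (kindP Call (While c) b).2; exists (rcons p true), s, y.
  split.
    apply: full_when => // a b /goP[p [t [y [s [ap [lp sh] _ _]]]]].
    have [|] := pselect (rel2 model snd_ a b); last by left.
    by move/(sndP b ap) => bp; right; exists p; split=> //; exists c, t, y.
  apply/all_full_cat; split.
    apply: full_projection => a /stopP[p [y [ap lp hr]]].
    exists p, (While c), (Node Leaf y), y; split=> // d e dt ey.
    by exists Leaf, y.
  apply: full_sequence => a /goP[p [t [y [s [ap [lp _] lp0 lp1]]]]].
  by exists p, (While c), t, y, c, s, (While c).
Qed.

Lemma full_axioms c : all_full model (axioms c).
Proof.
elim: c => [||||c IHc d IHd|c IHc d IHd|c IHc]; apply/all_full_cat;
  (split; first exact: full_step_axioms) => //.
- exact/all_full_cat.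
- exact/all_full_cat.
Qed.

Lemma holds_numeral n (a b : universe) : data a (num_tree n) -> holds model a b (numeral n).
Proof.
elim: n a b => [|n IH] a b /= an; first exact: an.
have [LT nT] := trees_node (element_tree an).
have [d dL] := tree_element LT; have [e en] := tree_element nT.
split; first by exists d; split=> //; exists Leaf, (num_tree n).
exists e; split; first by exists Leaf, (num_tree n).
by exists e; split=> //; apply: IH.
Qed.

Lemma holds_start n (a b : universe) : t0 = tup [:: n] -> holds model a b (start c0 n).
Proof.
move=> Et; have [|x x0] := step_element (p := [::]); first by rewrite l_root.
have [tT _] := trees_label l_root; have [d dt] := tree_element tT.
rewrite Et /= in tT dt; have [nT LT] := trees_node tT.
have [e eL] := tree_element LT; have [m mn] := tree_element nT.
exists x; split.
  split; first by apply: (kindP Call c0 x).2; exists [::], t0, y0.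
  split; last exact: node_tree x0.
  (* The root is the empty path, which does not end in [true], so it is fresh. *)
  by case=> -[|? ?]; rewrite /= x0 => -[].
exists d; split; first by apply: (argP d x0 l_root).2; rewrite Et.
split; first by exists e; split=> //; exists (num_tree n), Leaf.
exists m; split; first by exists (num_tree n), Leaf.
exact: holds_numeral.
Qed.

End Model.

Lemma halting_sentence_complete c n y : runs c (tup [:: n]) y ->
  exists (A : finType) (M : structure A), truth M (halting_sentence c n).
Proof.
move/derives_runs => [l [D [l_root l_der]]]; exists (universe l D), (model l_root l_der).
apply/truth_halting_sentence; split.
- exact: all_full_structural.
- exact: full_axioms.
- by move=> a b; apply: holds_start.
Qed.

(** * The reduction *)

Lemma enc_nat_inj m n s s' : enc_nat m ++ s = enc_nat n ++ s' -> m = n /\ s = s'.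
Proof.
elim: m n => [|m IH] [|n] //; first by case.
by case=> /IH[-> ->].
Qed.

Lemma enc_var_inj t u s s' : enc_var t ++ s = enc_var u ++ s' -> t = u /\ s = s'.
Proof. by case: t; case: u => -[]. Qed.

Lemma enc_atom_inj a a' s s' : enc_atom a ++ s = enc_atom a' ++ s' -> a = a' /\ s = s'.
Proof.
case: a => [t u|R t|R t u]; case: a' => [t' u'|R' t'|R' t' u']; rewrite /enc_atom -!catA;
  case/enc_nat_inj => // _.
- by case/enc_var_inj => -> /enc_var_inj[-> ->].
- by case/enc_nat_inj => -> /enc_var_inj[-> ->].
- by case/enc_nat_inj => -> /enc_var_inj[-> /enc_var_inj[-> ->]].
Qed.

Definition enc_head f :=
  match f with
  | Pos _ => 0 | Neg _ => 1 | And _ _ => 2 | Or _ _ => 3 | Forall _ _ => 4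
  | Exists _ _ _ => 5
  end.

Definition enc_tail f :=
  match f with
  | Pos a | Neg a => enc_atom a
  | And f g | Or f g => enc f ++ enc g
  | Forall v f => enc_var v ++ enc f
  | Exists v W f => enc_var v ++ [:: vx \in W; vy \in W] ++ enc f
  end.

Lemma encE f : enc f = enc_nat (enc_head f) ++ enc_tail f.
Proof. by case: f. Qed.

(** Stated with arbitrary suffixes, so that the induction passes through juxtaposed codes. Unique
    readability ensures that membership of a code speaks about the intended sentence. *)
Lemma enc_prefix f g s s' : enc f ++ s = enc g ++ s' -> f = g /\ s = s'.
Proof.
elim: f g s s' => [a|a|f IHf f' IHf'|f IHf f' IHf'|v f IH|v W f IH]
  [b|b|g g'|g g'|v' g|v' W' g] s s';
  rewrite !encE -!catA;
  case/enc_nat_inj => // _; rewrite /enc_tail -?catA.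
- by case/enc_atom_inj => -> ->.
- by case/enc_atom_inj => -> ->.
- by case/IHf => -> /IHf'[-> ->].
- by case/IHf => -> /IHf'[-> ->].
- by case/enc_var_inj => -> /IH[-> ->].
- case/enc_var_inj => -> [Ex Ey /IH[-> ->]]; split=> //; congr Exists.
  by apply/setP => -[].
Qed.

Lemma enc_inj : injective enc.
Proof. by move=> f g E; have [] := @enc_prefix f g [::] [::]; rewrite ?E. Qed.

(** The prefix does not depend on [n]; prepending it acts on word numbers as an affine map. *)
Definition prefixes (F G : nat -> formula) := exists pre, forall n, enc (F n) = pre ++ enc
  (G n).

Lemma prefixes_refl G : prefixes G G.
Proof. by exists [::]. Qed.

Lemma prefixes_and f F G : prefixes F G -> prefixes (fun n => And f (F n)) G.
Proof.
by case=> p E; exists (enc_nat 2 ++ enc f ++ p) => n; rewrite -!catA -E.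
Qed.

Lemma prefixes_forall v F G : prefixes F G -> prefixes (fun n => Forall v (F n)) G.
Proof.
by case=> p E; exists (enc_nat 4 ++ enc_var v ++ p) => n; rewrite -!catA -E.
Qed.

Lemma prefixes_exists v W F G : prefixes F G -> prefixes (fun n => Exists v W (F n)) G.
Proof.
case=> p E; exists (enc_nat 5 ++ enc_var v ++ [:: vx \in W; vy \in W] ++ p) => n.
by rewrite -!catA -E.
Qed.

Lemma word_num_catE v w : word_num (v ++ w) = 2 ^ size v * word_num w + word_num v.
Proof. by elim: v => [|b v /= ->]; rewrite ?expnS /=; lia. Qed.

(** Passing from [numeral n] to [numeral n.+1] prepends a fixed word, so the number of the code is
    an affine map iterated [n] times, followed by the affine map of the fixed part of the
    sentence. *)
Lemma recursive_halting_sentence c A : recursive A ->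
  recursive (fun s => word_num (enc (halting_sentence c (A s)))).
Proof.
have [pre Hpre] : prefixes (halting_sentence c) numeral.
  rewrite /halting_sentence /start; do 2!apply: prefixes_forall; apply: prefixes_and.
  apply: prefixes_exists; apply: prefixes_and; apply: prefixes_exists; apply: prefixes_and.
  by apply: prefixes_and; apply: prefixes_exists; apply/prefixes_and/prefixes_refl.
have [succ Hsucc] : prefixes (fun n => numeral n.+1) numeral.
  apply: prefixes_and; apply: prefixes_exists; apply: prefixes_and.
  by apply: prefixes_exists; apply/prefixes_and/prefixes_refl.
move=> cA; pose affine v x := 2 ^ size v * x + word_num v.
have c_affine v X : recursive X -> recursive (fun s => affine v (X s)).
  by move=> cX; apply: recursive_add (recursive_mul (recursive_const _) cX)
    (recursive_const _).
have := c_affine pre _ (recursive_rec (G := fun _ r _ => affine succ r) cA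
  (recursive_const (word_num (enc (numeral 0)))) (c_affine succ _ recursive_v1)).
apply: recursive_ext => s; rewrite Hpre word_num_catE /affine; congr (_ * _ + _).
elim: (A s) => [|n IH] //.
by rewrite Hsucc word_num_catE -IH.
Qed.

Lemma eval_fun n (e : recf n) v m m' : eval e v m -> eval e v m' -> m = m'.
Proof.
elim: e v m m' => [{}n||{}n i|k {}n f IHf g IHg|{}n f IHf g IHg|{}n f IHf] v m m'.
- by move=> -> ->.
- by move=> -> ->.
- by move=> -> ->.
- case=> w [Hw fw] [w' [Hw' fw']]; suff E : w = w' by apply: IHf fw _; rewrite E.
  by apply: eq_from_tnth => i; apply: IHg (Hw i) (Hw' i).
- case/tupleP: v => k u; rewrite !eval_prec; elim: k m m' => [|k IH] m m' /=; first exact: IHf.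
  by case=> r [/IH E er] [r' [/E <- er']]; apply: IHg er er'.
- case=> [e0 below] [e0' below'].
  case: (ltngtP m m') => // [/below'[r /IHf/(_ e0)]|/below[r /IHf/(_ e0')]] //.
Qed.

Lemma Sigma01_halting L : Sigma01 L ->
  exists e : recf 1, forall w, L w <-> exists m, eval e [tuple word_num w] m.
Proof.
case=> R [[e He] LR].
(* [Mu] searches on the first argument, but [R] takes its witness second. *)
pose swap (i : 'I_2) : recf 2 := Proj (rev_ord i).
have [sub Hsub] := recursive_sub (recursive_const 1) recursive_v0 1.
pose g : recf 2 := Comp sub (fun=> Comp e swap).
have Hg w u : eval g [tuple word_num u; word_num w] (1 - R w u).
  exists [tuple (R w u : nat)]; split; last exact: Hsub.
  move=> i; rewrite (ord1 i) tnth0; exists [tuple word_num w; word_num u]; split=> //.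
  by case=> -[|[|//]] i2; rewrite /= !(tnth_nth 0).
exists (Mu g) => w; rewrite LR; split.
  case=> u Ru.
  (* [Mu] finds the least zero of [1 - R], so the least number of a witness is taken; the predicate
     is made boolean classically. *)
  have ex : exists k, `[< exists u', word_num u' = k /\ R w u' >].
    by exists (word_num u); apply/asboolP; exists u.
  have [m /asboolP[u' [um Ru']] min_m] := ex_minnP ex; exists m; split.
    by have := Hg w u'; rewrite Ru' um.
  move=> k km; have [u'' uk] := word_num_onto k; exists 0.
  have := Hg w u''; case Ru'' : (R w u''); last by rewrite uk.
  suff /min_m : `[< exists u', word_num u' = k /\ R w u' >] by rewrite leqNgt km.
  by apply/asboolP; exists u''.
case=> m H; have [u um] := word_num_onto m; exists u.
have g0 : eval g [tuple word_num u; word_num w] 0 by rewrite um; exact: H.1.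
by have := eval_fun g0 (Hg w u); case: (R w u).
Qed.

Lemma FinSat_hard L : Sigma01 L -> many_one_reducible L FinSat_IF2.
Proof.
case/Sigma01_halting => e He; pose c := compile e.
exists (fun w => enc (halting_sentence c (word_num w))); split.
  have [r Hr] := recursive_halting_sentence c recursive_v0 1.
  by exists r => w; apply: Hr.
move=> w; rewrite He; split.
  case=> m em; exists (halting_sentence c (word_num w)); split=> //.
    by apply/setP => -[]; rewrite !inE.
  apply: (@halting_sentence_complete _ _ (num_tree m)).
  by apply/(compileP e [tuple word_num w]); exists m.
case=> f [/enc_inj <- _ [A [M /halting_sentence_sound[y]]]].
by move/(compileP e [tuple word_num w]) => [m _ em]; exists m.
Qed.

Theorem theorem4p20 : Sigma01_complete FinSat_IF2.
Proof. exact: (conj Sigma01_FinSat FinSat_hard). Qed.
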